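(* Fix $T_0>0$ and let $(X(t))_{t\ge0}$ be an irreducible continuous-time Markov chain on a finite state space $\mathcal{X}$ with generator matrix $Q$ and transition probabilities $p_{T_0}(x,y)$ over time $T_0$. Let $$I_{\mathrm{DVG}}(\rho):=\sup_{u\in\mathbb{R}^{\mathcal{X}},\ \min_xu_x>0}\ -\sum_{x\in\mathcal{X}}\frac{(Qu)_x}{u_x}\rho_x,\qquad\rho\in\mathcal{P}(\mathcal{X}),$$ which is the large-deviation rate functional (as $T\to\infty$, with speed $T$) of the occupation measure $T^{-1}\int_0^T\mathbf{1}_{X(t)}\,dt$. Then for every $\rho\in\mathcal{P}(\mathcal{X})$, $$I_{\mathrm{DVG}}(\rho)=\inf_{\substack{\theta\in\mathcal{P}(\mathcal{X}\times\mathcal{X})\\ e^1\#\theta=e^2\#\theta}}\ \inf_{\substack{k\in(\mathbb{R}^{\mathcal{X}})^{\mathcal{X}\times\mathcal{X}}\\ \sum_{x,y\in\mathcal{X}}k^{xy}=\rho}}\ I(k,\theta),$$ where $$I(k,\theta):=\begin{cases}\displaystyle\sum_{x,y\in\mathcal{X}}\theta_{xy}\,\phi^{xy*}\Big(\frac{k^{xy}}{\theta_{xy}}\Big)+\sum_{x,y\in\mathcal{X}}s\big(\theta_{xy}\mid(e^1\#\theta)_x\,p_{T_0}(x,y)\big), & k\ll\theta\ \text{and}\ e^1\#\theta=e^2\#\theta,\\ \infty,&\text{otherwise,}\end{cases}$$ $\phi^{xy}(\lambda):=\log\int e^{\lambda\cdot a}\,q^{xy}(da)$ and $\phi^{xy*}(a):=\sup_{\lambda\in\mathbb{R}^{\mathcal{X}}}[\lambda\cdot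 a-\phi^{xy}(\lambda)]$ for $\lambda,a\in\mathbb{R}^{\mathcal{X}}$, and $q^{xy}$ is the law of the occupation measure of the bridge, $$q^{xy}(d\rho)=\mathbb{P}\Big(\tfrac1{T_0}\int_0^{T_0}\mathbf{1}_{X(t)}\,dt\in d\rho\ \Big|\ X(0)=x,\ X(T_0)=y\Big).$$
   Context: $\mathbf{1}_{x}\in\mathbb{R}^{\mathcal{X}}$ denotes the unit vector (point mass) at $x$; $\mathcal{P}(\cdot)$ denotes probability measures on the given finite set, viewed as vectors. The function $s$ is $$s(a\mid b):=\begin{cases}a\log\frac ab-a+b,&a,b>0,\\ b,&a=0,\ b\ge0,\\ \infty,&\text{otherwise.}\end{cases}$$ Marginals: $(e^1\#\theta)_x:=\sum_y\theta_{xy}$, $(e^2\#\theta)_y:=\sum_x\theta_{xy}$. The notation $k\ll\theta$ means $k^{xy}=0$ whenever $\theta_{xy}=0$. Convention: $\theta_{xy}\phi^{xy*}(k^{xy}/\theta_{xy}):=0$ whenever $\theta_{xy}=0$ and $k^{xy}=0$. The law $q^{xy}$ is computed for the chain started at $x$ and conditioned on $X(T_0)=y$.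
   Formalization: The printed identity fails for T_0<1 (two-state chain with unit rates, ρ a point mass: I_DVG(ρ)=1 but the right side is at most T_0); the formal statement proves I_DVG(ρ) = (1/T_0) · inf_θ inf_k I(k,θ), which is the printed identity when T_0=1. *)

(* Defs.v *)
(* MathComp-Analysis *)
From HB Require Import structures.
From mathcomp Require Import all_boot all_order all_algebra.
From mathcomp Require Import all_classical all_reals all_analysis.

Set Implicit Arguments.
Unset Strict Implicit.
Unset Printing Implicit Defensive.

Import Order.TTheory GRing.Theory Num.Theory.
Import numFieldNormedType.Exports.
Local Open Scope classical_set_scope.
Local Open Scope ring_scope.

Definition is_prob (R : realType) (T : finType) (m : T -> R) : Prop :=
  (forall x, 0 <= m x) /\ \sum_x m x = 1.

Definition dot (R : realType) (S : finType) (l a : S -> R) : R :=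
  \sum_z l z * a z.

(* R^S with the product Borel sigma-algebra, generated by the coordinates. *)
Definition cylinders (R : realType) (S : finType) : set (set (S -> R)) :=
  [set A | exists z, exists2 B : set R, measurable B & A = [set a | B (a z)]].

Definition vec (R : realType) (S : finType) :=
  g_sigma_algebraType (@cylinders R S).

Section markov_chain.
Context (R : realType) (S : finType) (d : measure_display)
  (Omega : measurableType d).
(* P x is the law of the chain started at x. *)
Variables (P : S -> probability Omega R) (X : R -> Omega -> S).

Definition trans (t : R) (x y : S) : R := fine (P x [set w | X t w = y]).

(* The event that the path is at c.2 at time c.1, for each entry c of h. *)
Definition visits (h : seq (R * S)) : set Omega :=
  [set w | forall c, c \in h -> X c.1 w = c.2].

Record is_ctmc (Q : S -> S -> R) : Prop := IsCTMC {
  ctmc_measurable : forall (t : R) y, 0 <= t -> measurable [set w | X t w = y];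
  ctmc_right_continuous : forall w (t : R), 0 <= t ->
    \forall s \near t^'+, X s w = X t w;
  ctmc_left_limits : forall w (t : R), 0 < t ->
    exists y, \forall s \near t^'-, X s w = y;
  ctmc_start : forall x, P x [set w | X 0 w = x] = 1%E;
  (* The Markov property at time s, with homogeneous transitions. *)
  ctmc_markov : forall x (h : seq (R * S)) (s t : R) y z,
    0 <= s -> 0 <= t -> (forall c : R * S, c \in h -> 0 <= c.1 <= s) ->
    P x (visits h `&` [set w | X s w = y] `&` [set w | X (s + t) w = z]) =
    (P x (visits h `&` [set w | X s w = y]) * (trans t y z)%:E)%E;
  ctmc_generator : forall x y,
    (trans t x y - (x == y)%:R) / t @[t --> 0^'+] --> Q x y }.

Definition irreducible_chain : Prop :=
  forall x y, exists2 t : R, 0 <= t & 0 < trans t x y.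

Definition occupation (T0 : R) (w : Omega) : vec R S :=
  fun z => T0^-1 * \int[lebesgue_measure]_(t in `[0, T0]) (X t w == z)%:R.

(* P x conditioned on X T0 = y. As this event has positive probability, the
   division is the elementary one. *)
Definition bridge (T0 : R) (x y : S) (A : set Omega) : \bar R :=
  (P x (A `&` [set w | X T0 w = y]) / P x [set w | X T0 w = y])%E.

(* occupation T0 is measurable, since paths are right-continuous, so this
   pushforward is a genuine probability measure. *)
Definition bridge_law (T0 : R) (x y : S) : set (vec R S) -> \bar R :=
  pushforward (bridge T0 x y) (occupation T0).

Local Open Scope ereal_scope.

Definition phi (T0 : R) (x y : S) (l : S -> R) : \bar R :=
  lne (\int[bridge_law T0 x y]_(a in [set: vec R S]) (expR (dot l a))%:E).

Definition phi_conj (T0 : R) (x y : S) (a : S -> R) : \bar R :=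
  ereal_sup [set (dot l a)%:E - phi T0 x y l | l in [set: S -> R]].

Definition s_entropy (a b : R) : \bar R :=
  if ((0 < a) && (0 < b))%R then (a * ln (a / b) - a + b)%:E
  else if ((a == 0) && (0 <= b))%R then b%:E
  else +oo.

Definition marg1 (theta : S * S -> R) (x : S) : R :=
  (\sum_y theta (x, y))%R.

Definition marg2 (theta : S * S -> R) (y : S) : R :=
  (\sum_x theta (x, y))%R.

Definition abs_cont (k : S * S -> S -> R) (theta : S * S -> R) : Prop :=
  forall xy, theta xy = 0%R -> forall z, k xy z = 0%R.

(* This functional counts cost per time block of length T0, I_DVG below counts
   cost per unit of time; they are compared through the factor 1 / T0.
   When the guard holds, theta (x, y) = 0 forces k (x, y) = 0, so the value 0
   is used only for the convention 0 * phi_conj (0 / 0) = 0. *)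
Definition rate (T0 : R) (k : S * S -> S -> R) (theta : S * S -> R) : \bar R :=
  if `[< abs_cont k theta /\ marg1 theta =1 marg2 theta >] then
    \sum_(x : S) \sum_(y : S)
      (if theta (x, y) == 0%R then 0
       else (theta (x, y))%:E *
            phi_conj T0 x y (fun z => k (x, y) z / theta (x, y))%R) +
    \sum_(x : S) \sum_(y : S)
      s_entropy (theta (x, y)) (marg1 theta x * trans T0 x y)%R
  else +oo.

End markov_chain.

Definition I_DVG (R : realType) (S : finType) (Q : S -> S -> R)
    (rho : S -> R) : \bar R :=
  ereal_sup [set (- \sum_x ((\sum_y Q x y * u y) / u x * rho x))%:E
            | u in [set u : S -> R | forall x, 0 < u x]].

(* Main.v *)
Require Import Defs.
From mathcomp Require Import all_boot all_order all_algebra.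
From mathcomp Require Import all_classical all_reals all_analysis measurable_realfun.
From mathcomp Require Import ring lra.
Import Order.TTheory GRing.Theory Num.Theory.
Import numFieldNormedType.Exports.
Local Open Scope classical_set_scope.
Local Open Scope ring_scope.
Set Implicit Arguments.
Unset Strict Implicit.
Unset Printing Implicit Defensive.

(** Write [L] for the occupation measure over a block of length [T0] and, for a
    potential [W], let [M] be the tilted kernel with entries
    [E_x (exp (T0 W . L); X T0 = y)], so that the cumulant function of the bridge
    satisfies [exp (phi x y (T0 W)) = M x y / p x y]. By Feynman-Kac, [M] is the
    exponential of [T0 (Q + W)]; all that is used of this is that a function
    annihilated by [Q + W] is fixed by [M], and a row vector annihilated by
    [Q + W] is fixed by the transpose of [M].

    For every positive [u], the potential [W = - (Q u) / u] makes [u] harmonic for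
    [Q + W], hence [M u = u]. Testing each [phi_conj] with the multiplier [T0 W]
    and comparing [theta] with the stochastic kernel [M x y u y / u x] shows that
    every rate is at least [T0] times the value of the functional at [u]: the
    term in [log (u y / u x)] vanishes because the marginals of [theta] agree.
    This is [dvg_value_le_rate].

    Conversely, if [rho] is positive, a maximiser [u] exists, because the
    functional is coercive in [log u] modulo constants by irreducibility
    ([dvg_value_maximiser]). The first-order condition says that
    [m = rho / u] is annihilated by [Q + W] on the left
    ([maximiser_dual_harmonic]), i.e. [rho] is stationary for the chain
    transformed by [u]. The block law [theta x y = m x M x y u y] of that chain
    and the expected occupations [k] of its bridges turn all the inequalities of
    the first part into equalities ([positive_plan]); that [k / theta] is the
    gradient of [phi] at [T0 W] gives the equality in the Legendre transform. A
    general [rho] is a limit of positive ones, and the minimisers stay in a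
    compact set on which the rate is lower semicontinuous
    ([plan_closed], [optimal_plan]).

    The Feynman-Kac facts are obtained by discretisation. Right-continuity of the
    paths makes [L] a limit of Riemann sums, the Markov property turns
    expectations of products over a grid into products of operators
    [f |-> P_h (e^(h W) f)], and such an operator lowers any strict supersolution
    of [Q + W] when [h] is small ([tilt_supersolution]). *)

(** * Sums, limits and expectations of bounded random variables *)

Lemma sum_deltal (R : pzSemiRingType) (S : finType) (f : S -> R) x :
  \sum_y (x == y)%:R * f y = f x.
Proof.
rewrite (bigD1 x)//= eqxx mul1r big1 ?addr0// => y.
by rewrite eq_sym => /negbTE ->; rewrite mul0r.
Qed.

Lemma sum_deltar (R : pzSemiRingType) (S : finType) (f : S -> R) x :
  \sum_y f y * (y == x)%:R = f x.
Proof.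
rewrite (bigD1 x)//= eqxx mulr1 big1 ?addr0// => y /negbTE ->.
by rewrite mulr0.
Qed.

Lemma eq_of_le_sum (R : numDomainType) (I : finType) (a b : I -> R) :
  (forall i, a i <= b i) -> \sum_i a i = \sum_i b i -> a =1 b.
Proof.
move=> ab s i; apply/esym/eqP; rewrite -subr_eq0; apply/eqP.
have ba0 j : true -> 0 <= b j - a j by rewrite subr_ge0.
by apply: (psumr_eq0P ba0) => //; rewrite sumrB s subrr.
Qed.

Lemma cvg_bigsum (R : realType) (T I : Type) (F : set_system T) (s : seq I)
    (f : I -> T -> R) (l : I -> R) : Filter F ->
  (forall i, f i @ F --> l i) ->
  (\sum_(i <- s) f i t) @[t --> F] --> \sum_(i <- s) l i.
Proof.
move=> FF fl; elim: s => [|i s IH].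
  rewrite big_nil; under eq_fun do rewrite big_nil; exact: cvg_cst.
rewrite big_cons; under eq_fun do rewrite big_cons.
by apply: cvgD.
Qed.

Lemma Rintegral_bounded_cvg (d : measure_display) (T : measurableType d)
    (R : realType) (mu : {measure set T -> \bar R}) (D : set T) (M : R)
    (F : nat -> T -> R) (f : T -> R) :
  measurable D -> (mu D < +oo)%E ->
  (forall n, measurable_fun D (F n)) -> (forall n w, `|F n w| <= M) ->
  (forall w, D w -> F n w @[n --> \oo] --> f w) ->
  \int[mu]_(x in D) F n x @[n --> \oo] --> \int[mu]_(x in D) f x.
Proof.
move=> mD muD mF FM Ff.
have mf : measurable_fun D f by exact: (measurable_fun_cvg mF).
have iM : mu.-integrable D (EFin \o cst M).
  apply: measurable_bounded_integrable => //.
  by exists `|M|; split; [exact: num_real|move=> x Mx w _; exact: ltW].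
have [| |||if0 _] := @dominated_convergence _ T R mu D mD
  (fun n => EFin \o F n) (EFin \o f) (EFin \o cst M) _ _ _ iM _.
- by move=> n; exact/measurable_EFinP.
- exact/measurable_EFinP.
- apply/aeW => w Dw; apply/fine_cvgP; split; first exact: nearW.
  exact: Ff.
- by apply/aeW => w n _; rewrite /= lee_fin.
rewrite /Rintegral => h; apply: fine_cvg; rewrite fineK//.
exact: integrable_fin_num.
Qed.

Lemma Rintegral_sum (d : measure_display) (T : measurableType d)
    (R : realType) (mu : {measure set T -> \bar R}) (D : set T)
    (I : Type) (s : seq I) (F : I -> T -> R) :
  measurable D -> (forall i, mu.-integrable D (EFin \o F i)) ->
  \int[mu]_(x in D) (\sum_(i <- s) F i x) = \sum_(i <- s) \int[mu]_(x in D) F i x.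
Proof.
move=> mD iF; suff : mu.-integrable D (EFin \o (fun x => \sum_(i <- s) F i x)) /\
    \int[mu]_(x in D) (\sum_(i <- s) F i x) = \sum_(i <- s) \int[mu]_(x in D) F i x
  by case.
elim: s => [|i s [IH1 IH2]].
  rewrite (_ : (fun x => _) = cst 0); last first.
    by apply/funext => x; rewrite big_nil.
  by split; [exact: integrable0|rewrite Rintegral_cst// mul0r big_nil].
rewrite (_ : (fun x => _) = (fun x => F i x + \sum_(j <- s) F j x)); last first.
  by apply/funext => x; rewrite big_cons.
split; first by apply: eq_integrable (integrableD mD (iF i) IH1).
by rewrite RintegralD// big_cons IH2.
Qed.

Section bounded_expectation.
Context (d : measure_display) (T : measurableType d) (R : realType).
Implicit Types f g : T -> R.

Definition bounded_measurable f :=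
  measurable_fun [set: T] f /\ exists M : R, forall w, `|f w| <= M.

Lemma bmeas_cst c : bounded_measurable (fun=> c).
Proof. by split; [exact: measurable_cst|exists `|c|]. Qed.

Lemma bmeasD f g : bounded_measurable f -> bounded_measurable g ->
  bounded_measurable (fun w => f w + g w).
Proof.
move=> [mf [a fa]] [mg [b gb]]; split; first exact: measurable_funD.
by exists (a + b) => w; rewrite (le_trans (ler_normD _ _))// lerD.
Qed.

Lemma bmeasM f g : bounded_measurable f -> bounded_measurable g ->
  bounded_measurable (fun w => f w * g w).
Proof.
move=> [mf [a fa]] [mg [b gb]]; split; first exact: measurable_funM.
by exists (a * b) => w; rewrite normrM ler_pM.
Qed.

Lemma bmeas_sum (I : Type) (s : seq I) (F : I -> T -> R) :
  (forall i, bounded_measurable (F i)) ->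
  bounded_measurable (fun w => \sum_(i <- s) F i w).
Proof.
move=> bF; elim: s => [|i s IH].
  by under eq_fun do rewrite big_nil; exact: bmeas_cst.
by under eq_fun do rewrite big_cons; exact: bmeasD.
Qed.

Lemma bmeas_prod (I : Type) (s : seq I) (F : I -> T -> R) :
  (forall i, bounded_measurable (F i)) ->
  bounded_measurable (fun w => \prod_(i <- s) F i w).
Proof.
move=> bF; elim: s => [|i s IH].
  by under eq_fun do rewrite big_nil; exact: bmeas_cst.
by under eq_fun do rewrite big_cons; exact: bmeasM.
Qed.

Lemma bmeas_expR f : bounded_measurable f ->
  bounded_measurable (fun w => expR (f w)).
Proof.
move=> [mf [a fa]]; split; first exact: measurableT_comp.
exists (expR a) => w; rewrite ger0_norm ?expR_ge0// ler_expR.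
by rewrite (le_trans (ler_norm _)).
Qed.

Lemma bmeas_indic (A : set T) : measurable A -> bounded_measurable \1_A.
Proof.
move=> mA; split; first exact: measurable_indic.
by exists 1 => w; rewrite indicE; case: (_ \in _); rewrite ?normr1 ?normr0.
Qed.

Variable P : probability T R.

Definition expect f : R := \int[P]_w f w.

Lemma bmeas_integrable f : bounded_measurable f -> P.-integrable setT (EFin \o f).
Proof.
move=> [mf [M fM]]; apply: measurable_bounded_integrable => //.
  by rewrite (@le_lt_trans _ _ 1%E) ?ltry// probability_le1.
exists M; split; [exact: num_real|move=> x Mx w _ /=].
exact: (le_trans (fM w) (ltW Mx)).
Qed.

Lemma expectD f g : bounded_measurable f -> bounded_measurable g ->
  expect (fun w => f w + g w) = expect f + expect g.
Proof. by move=> bf bg; rewrite /expect RintegralD//; exact: bmeas_integrable. Qed.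

Lemma expectZ c f : bounded_measurable f -> expect (fun w => c * f w) = c * expect f.
Proof. by move=> bf; rewrite /expect RintegralZl//; exact: bmeas_integrable. Qed.

Lemma expect_cst c : expect (fun=> c) = c.
Proof.
rewrite /expect Rintegral_cst// [X in fine X](_ : _ = 1%E) ?mulr1//.
exact: probability_setT.
Qed.

Lemma expect_sum (I : Type) (s : seq I) (F : I -> T -> R) :
  (forall i, bounded_measurable (F i)) ->
  expect (fun w => \sum_(i <- s) F i w) = \sum_(i <- s) expect (F i).
Proof.
by move=> bF; apply: Rintegral_sum => // i; exact: bmeas_integrable.
Qed.

Lemma expect_ge0 f : (forall w, 0 <= f w) -> 0 <= expect f.
Proof. by move=> f0; exact: Rintegral_ge0. Qed.

Lemma expect_le f g : bounded_measurable f -> bounded_measurable g ->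
  (forall w, f w <= g w) -> expect f <= expect g.
Proof. by move=> bf bg fg; apply: le_Rintegral => //; exact: bmeas_integrable. Qed.

Lemma expect_indic (A : set T) : measurable A -> expect \1_A = fine (P A).
Proof.
move=> mA; rewrite /expect /Rintegral integral_indic//.
by rewrite setIT.
Qed.

Lemma expect_cvg (M : R) (F : nat -> T -> R) f :
  (forall n, measurable_fun setT (F n)) -> (forall n w, `|F n w| <= M) ->
  (forall w, F n w @[n --> \oo] --> f w) ->
  expect (F n) @[n --> \oo] --> expect f.
Proof.
move=> mF FM Ff; apply: (Rintegral_bounded_cvg (M := M)) => //.
by rewrite (@le_lt_trans _ _ 1%E) ?ltry// probability_le1.
Qed.

End bounded_expectation.

(** * Riemann sums along right-continuous paths *)

Definition mesh (R : realType) (T0 : R) (n : nat) : R := T0 / n.+1%:R.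

Lemma mesh_gt0 (R : realType) (T0 : R) n : 0 < T0 -> 0 < mesh T0 n.
Proof. by move=> T0_gt0; rewrite divr_gt0. Qed.

Lemma mesh_end (R : realType) (T0 : R) n : n.+1%:R * mesh T0 n = T0.
Proof. by rewrite /mesh mulrC divfK. Qed.

Lemma mesh_cvg0 (R : realType) (T0 : R) : mesh T0 n @[n --> \oo] --> 0.
Proof.
by rewrite /mesh -[X in _ --> X](mulr0 T0); apply: cvgMl_tmp; exact: cvg_harmonic.
Qed.

Lemma near_mesh (R : realType) (T0 : R) (A : R -> Prop) : 0 < T0 ->
  (\forall h \near 0^'+, A h) -> \forall n \near \oo, A (mesh T0 n).
Proof.
move=> T0_gt0 [e /= e0 He]; have /cvgr_lt/(_ _ e0) := mesh_cvg0 T0.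
apply: filterS => n ne; have m0 := mesh_gt0 n T0_gt0.
by apply: He => //=; rewrite sub0r normrN gtr0_norm.
Qed.

Section riemann_sums.
Context (R : realType) (S : eqType) (x : R -> S) (T0 : R).
Hypothesis T0_gt0 : 0 < T0.
Hypothesis x_right_continuous :
  forall t : R, 0 <= t -> \forall s \near t^'+, x s = x t.
Variable z : S.

Local Notation h := (mesh T0).
Let cell n i : set R := `[i%:R * h n, i.+1%:R * h n[.
Let step n (t : R) : R :=
  \sum_(i < n.+1) \1_(cell n i) t * (x (i.+1%:R * h n) == z)%:R.

Let h_gt0 n : 0 < h n. Proof. exact: mesh_gt0. Qed.

Let cell_index n t : 0 <= t < T0 ->
  exists i : 'I_n.+1, i%:R * h n <= t < i.+1%:R * h n.
Proof.
move=> /andP[t0 tT].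
have : 0 <= t / h n by rewrite divr_ge0// ltW.
move=> /Num.Theory.truncn_itv; rewrite ler_pdivlMr// ltr_pdivrMr// => it.
have iN : (Num.truncn (t / h n) < n.+1)%N.
  rewrite -(ltr_nat R) -(ltr_pM2r (h_gt0 n)).
  move: it => /andP[/le_lt_trans + _]; apply.
  by rewrite mesh_end.
by exists (Ordinal iN).
Qed.

Let step_near n t : 0 <= t < T0 ->
  exists2 s, t < s <= t + h n & step n t = (x s == z)%:R.
Proof.
move=> /(cell_index n)[i /andP[it ti]]; exists (i.+1%:R * h n).
  by rewrite ti -natr1 mulrDl mul1r lerD2r.
rewrite /step (bigD1 i)//= big1 ?addr0.
  rewrite indicE mem_set ?mul1r// /cell/= in_itv/=.
  by rewrite it ti.
move=> j ji; rewrite indicE memNset ?mul0r// /cell/= in_itv/= => /andP[jt tj].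
have := le_lt_trans jt ti; have := le_lt_trans it tj.
rewrite !ltr_pM2r// !ltr_nat !ltnS => ij ji'.
by move: ji; apply/negP; rewrite negbK -val_eqE/= eqn_leq ij ji'.
Qed.

Let step_cvg t : 0 <= t < T0 ->
  step n t @[n --> \oo] --> ((x t == z)%:R : R).
Proof.
move=> tT; have /andP[t0 _] := tT.
have [e /= e0 He] := x_right_continuous t0.
apply: cvg_near_cst.
have : \forall n \near \oo, h n < e.
  by have /cvgr_lt := mesh_cvg0 T0; apply.
apply: filterS => n hn; have [s /andP[ts sh] ->] := step_near n tT.
rewrite He//= ltr0_norm ?subr_lt0// opprB ltrBlDr addrC.
by rewrite (le_lt_trans sh)// ltrD2l.
Qed.

Let cell_sub n (i : 'I_n.+1) t : cell n i t -> 0 <= t < T0.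
Proof.
rewrite /cell/= in_itv/= => /andP[it ti]; apply/andP; split.
  by rewrite (le_trans _ it)// mulr_ge0// ltW.
rewrite (lt_le_trans ti)// /mesh mulrCA ger_pMr//.
by rewrite ler_pdivrMr// mul1r ler_nat.
Qed.

Let step_le1 n t : `|step n t| <= 1.
Proof.
have [tT|tT] := boolP (0 <= t < T0).
  have [s _ ->] := step_near n tT.
  by case: (_ == _); rewrite ?normr1 ?normr0.
rewrite /step big1 ?normr0// => i _; rewrite indicE memNset ?mul0r//.
by move=> /cell_sub; exact/negP.
Qed.

Let measurable_step n (D : set R) : measurable_fun D (step n).
Proof.
apply: measurable_sum => i; apply: measurable_funM.
  by apply: measurable_indic; exact: measurable_itv.
exact: measurable_cst.
Qed.

Let D : set R := `[0, T0[.
Let mD : measurable D. Proof. exact: measurable_itv. Qed.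
Let muD : (lebesgue_measure D < +oo)%E.
Proof. by rewrite /D lebesgue_measure_itv/= lte_fin T0_gt0 oppr0 adde0 ltry. Qed.

Let natb_le1 (b : bool) : `|b%:R : R| <= 1.
Proof. by case: b; rewrite ?normr1 ?normr0. Qed.

Let integrable_le1 (f : R -> R) : measurable_fun D f ->
  (forall t, `|f t| <= 1) -> lebesgue_measure.-integrable D (EFin \o f).
Proof.
move=> mf f1; apply: measurable_bounded_integrable => //.
exists 1; split; [exact: num_real|move=> r r1 t _ /=].
exact: (le_trans (f1 t) (ltW r1)).
Qed.

Let Rintegral_step n :
  \int[lebesgue_measure]_(t in D) step n t =
  h n * \sum_(i < n.+1) (x (i.+1%:R * h n) == z)%:R.
Proof.
rewrite Rintegral_sum//; last first.
  move=> i; apply: integrable_le1 => [|t]; last by rewrite indicE -natrM mulnb.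
  apply: measurable_funM; last exact: measurable_cst.
  by apply: measurable_indic; exact: measurable_itv.
rewrite mulr_sumr; apply: eq_bigr => i _.
rewrite RintegralZr//; last first.
  apply: integrable_le1 => [|t]; last by rewrite indicE.
  by apply: measurable_indic; exact: measurable_itv.
congr (_ * _); rewrite /Rintegral integral_indic//; last exact: measurable_itv.
rewrite (_ : _ `&` _ = cell n i); last first.
  by apply/setIidPl => t /cell_sub; rewrite /D /= in_itv.
apply: (congr1 fine (y := (h n)%:E)).
apply: etrans (lebesgue_measure_itv _) _.
rewrite /= lte_fin ltr_pM2r// ltr_nat ltnSn/= -EFinB.
by rewrite -mulrBl -natr1 addrAC subrr add0r mul1r.
Qed.

(** Sampling at right endpoints approaches each time from the right, so
    right-continuity alone makes the step functions converge pointwise, and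
    dominated convergence does the rest. *)
Lemma riemann_sum_cvg :
  n.+1%:R^-1 * \sum_(i < n.+1) (x (i.+1%:R * mesh T0 n) == z)%:R
    @[n --> \oo] -->
  T0^-1 * \int[lebesgue_measure]_(t in `[0, T0]) ((x t == z)%:R : R).
Proof.
have mg : measurable_fun D (fun t => (x t == z)%:R : R).
  by apply: (measurable_fun_cvg (h := step)) => // t;
    rewrite /D/= in_itv/=; exact: step_cvg.
rewrite -Rintegral_itv_bndo_bndc; last first.
  exact: integrable_le1.
have : T0^-1 * \int[lebesgue_measure]_(t in D) step n t @[n --> \oo] -->
  T0^-1 * \int[lebesgue_measure]_(t in D) ((x t == z)%:R : R).
  have bounded_cvg := @Rintegral_bounded_cvg _ _ R lebesgue_measure D 1 step
    (fun t => (x t == z)%:R) mD muD (fun n => @measurable_step n D) step_le1.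
  apply: cvgMl_tmp; apply: bounded_cvg.
  by move=> t Dt; apply: step_cvg; move: Dt; rewrite /D/= in_itv.
apply: cvg_trans; apply: near_eq_cvg; apply: nearW => n.
rewrite Rintegral_step mulrA; congr (_ * _).
by rewrite /mesh mulrA mulVf ?mul1r// gt_eqF.
Qed.

End riemann_sums.

(** * The Markov property for functionals of the past *)

Section chain.
Context (R : realType) (S : finType) (d : measure_display)
  (Omega : measurableType d) (P : S -> probability Omega R)
  (X : R -> Omega -> S) (Q : S -> S -> R).
Hypothesis hX : is_ctmc P X Q.
Implicit Types (f : S -> R) (s t h : R) (x y z : S).

Local Notation p := (trans P X).

Definition semigroup t f x : R := \sum_y trans P X t x y * f y.

Lemma state_sum f t w : f (X t w) = \sum_y f y * \1_[set w | X t w = y] w.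
Proof.
rewrite (bigD1 (X t w))//= big1 ?addr0.
  by rewrite indicE mem_set ?mulr1.
by move=> y yX; rewrite indicE memNset ?mulr0//= => e; rewrite e eqxx in yX.
Qed.

Lemma bmeas_state f t : 0 <= t -> bounded_measurable (fun w => f (X t w)).
Proof.
move=> t0; under eq_fun do rewrite state_sum.
apply: bmeas_sum => y; apply: bmeasM; first exact: bmeas_cst.
by apply: bmeas_indic; exact: (ctmc_measurable hX).
Qed.

Lemma expect_state x t f : 0 <= t ->
  expect (P x) (fun w => f (X t w)) = semigroup t f x.
Proof.
move=> t0; under [in LHS]eq_fun do rewrite state_sum.
rewrite expect_sum; last first.
  move=> y; apply: bmeasM; first exact: bmeas_cst.
  by apply: bmeas_indic; exact: (ctmc_measurable hX).
apply: eq_bigr => y _; rewrite expectZ; last first.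
  by apply: bmeas_indic; exact: (ctmc_measurable hX).
rewrite mulrC; congr (_ * _); rewrite expect_indic//.
exact: (ctmc_measurable hX).
Qed.

Lemma trans_ge0 t x y : 0 <= p t x y.
Proof. by rewrite fine_ge0. Qed.

Lemma trans_sum1 t x : 0 <= t -> \sum_y p t x y = 1.
Proof.
move=> t0; rewrite -(expect_cst (P x) 1) (expect_state x (fun=> 1) t0).
by apply: eq_bigr => y _; rewrite mulr1.
Qed.

Lemma trans0 x y : p 0 x y = (x == y)%:R.
Proof.
have px : p 0 x x = 1 by rewrite /trans (ctmc_start hX).
have [<-//|xy] := eqVneq x y.
have := trans_sum1 x (lexx 0); rewrite (bigD1 x)//= px => sum1.
have sum0 : \sum_(z | z != x) p 0 x z = 0.
  by apply: (addrI 1); rewrite addr0.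
have p_ge0 z : z != x -> 0 <= p 0 x z by move=> _; exact: trans_ge0.
by apply: (psumr_eq0P p_ge0 sum0); rewrite eq_sym.
Qed.

Lemma semigroup0 f x : semigroup 0 f x = f x.
Proof.
by rewrite /semigroup; under eq_bigr do rewrite trans0; exact: sum_deltal.
Qed.

Lemma semigroup_indic t x y : semigroup t (fun z => (z == y)%:R) x = p t x y.
Proof. exact: sum_deltar. Qed.

Lemma measurable_visits (h : seq (R * S)) :
  (forall c, c \in h -> 0 <= c.1) -> measurable (visits X h).
Proof.
elim: h => [_|c h IH h0].
  by rewrite (_ : visits _ _ = setT)//; apply/seteqP; split.
rewrite (_ : visits X (c :: h) = [set w | X c.1 w = c.2] `&` visits X h).
  apply: measurableI.
    by apply: (ctmc_measurable hX); apply: h0; rewrite mem_head.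
  by apply: IH => e eh; apply: h0; rewrite inE eh orbT.
apply/seteqP; split => w /=.
  move=> H; split; first by apply: H; rewrite mem_head.
  by move=> e eh; apply: H; rewrite inE eh orbT.
by move=> [wc H] e; rewrite inE => /predU1P[->//|/H].
Qed.

Lemma visits_cons c (h : seq (R * S)) w :
  \1_(visits X (c :: h)) w = \1_[set w | X c.1 w = c.2] w * \1_(visits X h) w :> R.
Proof.
rewrite -[RHS]/((\1_[set w | X c.1 w = c.2] \* \1_(visits X h)) w) -indicI.
congr (\1_ _ w); apply/seteqP; split => u /=.
  move=> H; split; first by apply: H; rewrite mem_head.
  by move=> e eh; apply: H; rewrite inE eh orbT.
by move=> [wc H] e; rewrite inE => /predU1P[->//|/H].
Qed.

Definition past_weight (l : seq (R * (S -> R))) (w : Omega) : R :=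
  \prod_(c <- l) c.2 (X c.1 w).

Lemma bmeas_past_weight l : (forall c, c \in l -> 0 <= c.1) ->
  bounded_measurable (past_weight l).
Proof.
elim: l => [_|c l IH l0].
  rewrite (_ : past_weight _ = fun=> 1); first exact: bmeas_cst.
  by apply/funext => w; rewrite /past_weight big_nil.
rewrite (_ : past_weight _ = fun w => c.2 (X c.1 w) * past_weight l w); last first.
  by apply/funext => w; rewrite /past_weight big_cons.
apply: bmeasM; first by apply: bmeas_state; apply: l0; rewrite mem_head.
by apply: IH => e el; apply: l0; rewrite inE el orbT.
Qed.

Let markov_visits x s t f (h : seq (R * S)) : 0 <= s -> 0 <= t ->
  (forall c, c \in h -> 0 <= c.1 <= s) ->
  expect (P x) (fun w => \1_(visits X h) w * f (X (s + t) w)) =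
  expect (P x) (fun w => \1_(visits X h) w * semigroup t f (X s w)).
Proof.
move=> s0 t0 hs.
have mV : measurable (visits X h).
  by apply: measurable_visits => c /hs /andP[].
have mX r y : 0 <= r -> measurable [set w | X r w = y] by exact: ctmc_measurable hX _ _.
have st0 : 0 <= s + t by exact: addr_ge0.
pose V y := visits X h `&` [set w | X s w = y].
have mVy y : measurable (V y) by apply: measurableI => //; exact: mX.
have -> : (fun w => \1_(visits X h) w * semigroup t f (X s w)) =
    (fun w => \sum_y semigroup t f y * \1_(V y) w).
  apply/funext => w; rewrite (state_sum (semigroup t f)) mulr_sumr.
  by apply: eq_bigr => y _; rewrite mulrCA /V indicI.
rewrite expect_sum; last first.
  by move=> y; apply: bmeasM; [exact: bmeas_cst|exact: bmeas_indic].
have -> : (fun w => \1_(visits X h) w * f (X (s + t) w)) =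
    (fun w => \sum_y \sum_z f z * \1_(V y `&` [set w | X (s + t) w = z]) w).
  apply/funext => w.
  have -> : \1_(visits X h) w * f (X (s + t) w) =
      \sum_y (\1_(visits X h) w * f (X (s + t) w)) * \1_[set w | X s w = y] w.
    exact: (state_sum (fun=> \1_(visits X h) w * f (X (s + t) w))).
  apply: eq_bigr => y _; rewrite (state_sum f) mulr_sumr mulr_suml.
  apply: eq_bigr => z _; rewrite !indicI /=.
  by rewrite mulrCA -!mulrA; congr (_ * _); congr (_ * _); rewrite mulrC.
rewrite expect_sum; last first.
  move=> y; apply: bmeas_sum => z; apply: bmeasM; first exact: bmeas_cst.
  by apply: bmeas_indic; apply: measurableI => //; exact: mX.
apply: eq_bigr => y _.
rewrite expectZ; last exact: bmeas_indic.
rewrite expect_sum; last first.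
  move=> z; apply: bmeasM; first exact: bmeas_cst.
  by apply: bmeas_indic; apply: measurableI => //; exact: mX.
rewrite mulr_suml; apply: eq_bigr => z _.
have mVz : measurable (V y `&` [set w | X (s + t) w = z]).
  by apply: measurableI => //; exact: mX.
rewrite expectZ ?expect_indic//; last exact: bmeas_indic.
have fP : P x (V y) \is a fin_num by exact: fin_num_measure.
rewrite /V (ctmc_markov hX x y z s0 t0 hs) -/(V y) fineM//.
by rewrite /=; ring.
Qed.

(** Expanding each past factor over the states it may see reduces the claim to
    the cylinder form of the Markov property. *)
Lemma markov_past x s t f l : 0 <= s -> 0 <= t ->
  (forall c, c \in l -> 0 <= c.1 <= s) ->
  expect (P x) (fun w => past_weight l w * f (X (s + t) w)) =
  expect (P x) (fun w => past_weight l w * semigroup t f (X s w)).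
Proof.
move=> s0 t0.
suff H (h : seq (R * S)) : (forall c, c \in h -> 0 <= c.1 <= s) ->
    (forall c, c \in l -> 0 <= c.1 <= s) ->
    expect (P x) (fun w => \1_(visits X h) w * past_weight l w * f (X (s + t) w)) =
    expect (P x) (fun w => \1_(visits X h) w * past_weight l w * semigroup t f (X s w)).
  have v1 w : \1_(visits X [::]) w = 1 :> R by rewrite indicE mem_set.
  have h0 (c : R * S) : c \in [::] -> 0 <= c.1 <= s by [].
  move=> /(H [::] h0) E; apply: etrans (etrans E _); by congr expect; apply/funext => w;
    rewrite v1 mul1r.
elim: l h => [|c l IH] h hs ls.
  have E w : past_weight [::] w = 1 by rewrite /past_weight big_nil.
  have := markov_visits x f s0 t0 hs.
  move=> M; apply: etrans (etrans M _);
    by congr expect; apply/funext => w; rewrite E mulr1.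
have cs : 0 <= c.1 <= s by apply: ls; rewrite mem_head.
have {}ls e : e \in l -> 0 <= e.1 <= s by move=> el; apply: ls; rewrite inE el orbT.
have split_c (F : Omega -> R) :
    (fun w => \1_(visits X h) w * past_weight (c :: l) w * F w) =
    (fun w => \sum_a c.2 a * (\1_(visits X ((c.1, a) :: h)) w * past_weight l w * F w)).
  apply/funext => w; rewrite /past_weight big_cons (state_sum c.2).
  rewrite -/(past_weight l w) mulr_suml mulr_sumr mulr_suml.
  by apply: eq_bigr => a _; rewrite visits_cons /=; ring.
have hs' a e : e \in (c.1, a) :: h -> 0 <= e.1 <= s.
  by rewrite inE => /predU1P[->//|/hs].
have bV a : bounded_measurable (fun w => \1_(visits X ((c.1, a) :: h)) w : R).
  by apply: bmeas_indic; apply: measurable_visits => e /hs' /andP[].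
have bl : bounded_measurable (past_weight l).
  by apply: bmeas_past_weight => e /ls /andP[].
have b1 r F a : 0 <= r ->
    bounded_measurable (fun w =>
      \1_(visits X ((c.1, a) :: h)) w * past_weight l w * F (X r w)).
  move=> r0; apply: bmeasM; last exact: bmeas_state.
  exact: bmeasM.
have st0 : 0 <= s + t by exact: addr_ge0.
rewrite !split_c !expect_sum; last 2 first.
- by move=> a; apply: bmeasM; [exact: bmeas_cst|exact: b1].
- by move=> a; apply: bmeasM; [exact: bmeas_cst|exact: b1].
apply: eq_bigr => a _; rewrite !expectZ; last 2 first.
- exact: b1.
- exact: b1.
by congr (_ * _); apply: IH => //; exact: hs'.
Qed.

Lemma trans_semigroup s t x y : 0 <= s -> 0 <= t ->
  p (s + t) x y = \sum_z p s x z * p t z y.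
Proof.
move=> s0 t0.
have := @markov_past x s t (fun z => (z == y)%:R) [::] s0 t0 ltac:(by []).
have E w : past_weight [::] w = 1 by rewrite /past_weight big_nil.
under [in LHS]eq_fun do rewrite E mul1r.
under [in RHS]eq_fun do rewrite E mul1r.
rewrite (expect_state x (fun z => (z == y)%:R)) ?addr_ge0//.
rewrite (expect_state x (semigroup t _))// semigroup_indic => ->.
by apply: eq_bigr => z _; rewrite semigroup_indic.
Qed.

(** The operators are composed from the last time point inwards, because the
    Markov property removes the last factor of a product along the path. *)
Fixpoint weighted_steps h (g : nat -> S -> R) (n : nat) f : S -> R :=
  if n is m.+1 then
    weighted_steps h g m (semigroup h (fun y => g m y * f y))
  else f.

Lemma expect_weighted_steps h (g : nat -> S -> R) n f x : 0 <= h ->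
  expect (P x) (fun w => (\prod_(i < n) g i (X (i.+1%:R * h) w)) * f (X (n%:R * h) w)) =
  weighted_steps h g n f x.
Proof.
move=> h0; elim: n f => [|n IH] f.
  under eq_fun do rewrite big_ord0 mul1r mul0r.
  by rewrite expect_state// semigroup0.
rewrite /= -IH.
pose l := [seq (i.+1%:R * h, g i) | i : 'I_n].
have lE w : past_weight l w = \prod_(i < n) g i (X (i.+1%:R * h) w).
  by rewrite /past_weight big_image.
have ls c : c \in l -> 0 <= c.1 <= n%:R * h.
  by case/mapP => i _ -> /=; rewrite mulr_ge0//= ler_wpM2r// ler_nat.
have := @markov_past x (n%:R * h) h (fun y => g n y * f y) l _ h0 ls.
rewrite mulr_ge0// => /(_ isT) M.
under [in RHS]eq_fun do rewrite -lE.
rewrite -{}M; congr expect; apply/funext => w.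
by rewrite big_ord_recr/= lE -natr1 mulrDl mul1r mulrA.
Qed.

End chain.

(** * Expansion of the weighted semigroup at time zero *)

Section generator.
Context (R : realType) (S : finType) (d : measure_display)
  (Omega : measurableType d) (P : S -> probability Omega R)
  (X : R -> Omega -> S) (Q : S -> S -> R).
Hypothesis hX : is_ctmc P X Q.
Implicit Types (f m W : S -> R) (s t h : R) (x y z : S).

Local Notation p := (trans P X).

Let right0_cvg : h @[h --> (0:R)^'+] --> (0 : R).
Proof. by apply: cvg_at_right_filter; exact: cvg_id. Qed.

Lemma expR_slope_cvg (c : R) : (expR (h * c) - 1) / h @[h --> 0^'+] --> c.
Proof.
have up : c / (1 - h * c) @[h --> (0:R)^'+] --> c.
  rewrite -[X in _ --> X]divr1; apply: cvgM; first exact: cvg_cst.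
  apply: cvgV; first exact: oner_neq0.
  rewrite -[X in _ --> X]subr0; apply: cvgB; first exact: cvg_cst.
  rewrite -[X in _ --> X](mul0r c); apply: cvgMr_tmp.
  exact: right0_cvg.
apply: squeeze_cvgr (cvg_cst c) up.
have : \forall h \near (0:R)^'+, 0 < 1 - h * c.
  have : 1 - h * c @[h --> (0:R)^'+] --> (1 : R).
    rewrite -[X in _ --> X]subr0; apply: cvgB; first exact: cvg_cst.
    rewrite -[X in _ --> X](mul0r c); apply: cvgMr_tmp.
    exact: right0_cvg.
  by move/cvgr_gt; apply; exact: ltr01.
have : \forall h \near (0:R)^'+, 0 < h by exact: nbhs_right_gt.
apply: filterS2 => h h0 hc.
rewrite ler_pdivlMr// ler_pdivrMr//; apply/andP; split.
  by rewrite lerBrDr addrC mulrC expR_ge1Dx.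
have := expR_ge1Dx (- (h * c)); rewrite expRN => H.
have E : expR (h * c) <= (1 - h * c)^-1.
  by rewrite -[leLHS]invrK lef_pV2// posrE invr_gt0 expR_gt0.
rewrite (le_trans (lerD E (lexx _)))// le_eqVlt; apply/orP; left; apply/eqP.
by field; rewrite gt_eqF.
Qed.

Lemma trans_slope_cvg W x y :
  (p h x y * expR (h * W y) - (x == y)%:R) / h @[h --> 0^'+]
    --> Q x y + (x == y)%:R * W y.
Proof.
have e1 : expR (h * W y) @[h --> (0:R)^'+] --> (1 : R).
  rewrite -[X in _ --> X](expR0 R); apply: continuous_cvg; first exact: continuous_expR.
  rewrite -[X in _ --> X](mul0r (W y)); apply: cvgMr_tmp.
  exact: right0_cvg.
have : (p h x y - (x == y)%:R) / h * expR (h * W y) +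
    (x == y)%:R * ((expR (h * W y) - 1) / h) @[h --> 0^'+]
    --> Q x y * 1 + (x == y)%:R * W y.
  apply: cvgD; first by apply: cvgM => //; exact: ctmc_generator hX _ _.
  by apply: cvgMl_tmp; exact: expR_slope_cvg.
rewrite mulr1; apply: cvg_trans; apply: near_eq_cvg; apply: nearW => h.
by ring.
Qed.

(** The operator [f |-> P_h (e^(h W) f)] equals [f + h (Q + W) f + o(h)], and its
    transpose acts on row vectors in the same way. *)
Lemma generator_slope_cvg W f x :
  (semigroup P X h (fun y => expR (h * W y) * f y) x - f x) / h @[h --> 0^'+]
    --> (\sum_y Q x y * f y) + W x * f x.
Proof.
have -> : (\sum_y Q x y * f y) + W x * f x =
    \sum_y (Q x y + (x == y)%:R * W y) * f y.
  rewrite -(sum_deltal (fun y => W y * f y)) -big_split/=.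
  by apply: eq_bigr => y _; ring.
have : \sum_y ((p h x y * expR (h * W y) - (x == y)%:R) / h * f y) @[h --> 0^'+]
    --> \sum_y (Q x y + (x == y)%:R * W y) * f y.
  apply: cvg_bigsum => y; apply: cvgMr_tmp; exact: trans_slope_cvg.
apply: cvg_trans; apply: near_eq_cvg; apply: nearW => h.
rewrite -[f x]sum_deltal /semigroup -sumrB mulr_suml; apply: eq_bigr => y _.
by ring.
Qed.

Lemma dual_generator_slope_cvg W m y :
  ((\sum_x m x * p h x y) * expR (h * W y) - m y) / h @[h --> 0^'+]
    --> (\sum_x m x * Q x y) + m y * W y.
Proof.
have mE : m y = \sum_x m x * (x == y)%:R by rewrite sum_deltar.
have -> : (\sum_x m x * Q x y) + m y * W y =
    \sum_x m x * (Q x y + (x == y)%:R * W y).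
  under [RHS]eq_bigr do rewrite mulrDr; rewrite big_split/=; congr (_ + _).
  by rewrite {1}mE mulr_suml; apply: eq_bigr => x _; rewrite mulrA.
have : \sum_x (m x * ((p h x y * expR (h * W y) - (x == y)%:R) / h)) @[h --> 0^'+]
    --> \sum_x m x * (Q x y + (x == y)%:R * W y).
  apply: cvg_bigsum => x; apply: cvgMl_tmp; exact: trans_slope_cvg.
apply: cvg_trans; apply: near_eq_cvg; apply: nearW => h.
rewrite mE mulr_suml -sumrB mulr_suml; apply: eq_bigr => x _.
by ring.
Qed.

Lemma near_slope_le0 (F : R -> S -> R) (f l : S -> R) :
  (forall x, (F h x - f x) / h @[h --> 0^'+] --> l x) ->
  (forall x, l x < 0) -> \forall h \near 0^'+, forall x, F h x <= f x.
Proof.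
move=> Fl l0; apply: filter_forall => x.
have : \forall h \near (0:R)^'+, 0 < h by exact: nbhs_right_gt.
have : \forall h \near (0:R)^'+, (F h x - f x) / h < 0.
  by have /cvgr_lt := Fl x; apply; exact: l0.
apply: filterS2 => h Ff h0; rewrite -subr_le0 ltW//.
by move: Ff; rewrite pmulr_llt0// invr_gt0.
Qed.

End generator.

(** * Tilted expectations as limits of discrete products *)

Section tilted_expectations.
Context (R : realType) (S : finType) (d : measure_display)
  (Omega : measurableType d) (P : S -> probability Omega R)
  (X : R -> Omega -> S) (Q : S -> S -> R).
Hypothesis hX : is_ctmc P X Q.
Implicit Types (f m W : S -> R) (s t h : R) (x y z : S).

Local Notation semi := (semigroup P X).
Local Notation steps := (weighted_steps P X).

Lemma semigroup_le h f f' x : (forall y, f y <= f' y) -> semi h f x <= semi h f' x.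
Proof.
by move=> ff'; apply: ler_sum => y _; rewrite ler_wpM2l// trans_ge0.
Qed.

Lemma weighted_steps_le h (g : nat -> S -> R) n f f' x :
  (forall i y, 0 <= g i y) -> (forall y, f y <= f' y) ->
  steps h g n f x <= steps h g n f' x.
Proof.
move=> g0; elim: n f f' => [|n IH] f f' ff' //=.
by apply: IH => y; apply: semigroup_le => z; rewrite ler_wpM2l.
Qed.

Lemma weighted_steps_supersolution h (g : nat -> S -> R) n f x :
  (forall i y, 0 <= g i y) ->
  (forall i y, semi h (fun z => g i z * f z) y <= f y) ->
  steps h g n f x <= f x.
Proof.
move=> g0 gf; elim: n x => [//|n IH] x /=.
by apply: le_trans (IH x); apply: weighted_steps_le => // y; exact: gf.
Qed.

Lemma weighted_steps_subsolution h (g : nat -> S -> R) n f x :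
  (forall i y, 0 <= g i y) ->
  (forall i y, f y <= semi h (fun z => g i z * f z) y) ->
  f x <= steps h g n f x.
Proof.
move=> g0 gf; elim: n x => [//|n IH] x /=.
by apply: le_trans (IH x) _; apply: weighted_steps_le => // y; exact: gf.
Qed.

(** The row vector [m] absorbs the steps from the left, as a supersolution does
    from the right; this needs test functions [f] of constant sign. *)
Lemma weighted_steps_dual h (g : nat -> S -> R) n f m :
  (forall x, 0 <= m x) -> (forall i y, 0 <= g i y) -> (forall y, 0 <= f y) ->
  (forall i y, (\sum_x m x * trans P X h x y) * g i y <= m y) ->
  \sum_x m x * steps h g n f x <= \sum_x m x * f x.
Proof.
move=> m0 g0 + mg; elim: n f => [//|n IH] f f0 /=.
apply: le_trans (IH _ _) _.
  by move=> y; apply: sumr_ge0 => z _; rewrite mulr_ge0 ?trans_ge0// mulr_ge0.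
under [X in X <= _]eq_bigr do rewrite /semigroup mulr_sumr.
rewrite exchange_big/=; apply: ler_sum => y _.
under eq_bigr do rewrite !mulrA; rewrite -!mulr_suml.
by rewrite ler_wpM2r.
Qed.

Lemma near_supersolution W f :
  (forall x, \sum_y Q x y * f y + W x * f x < 0) ->
  \forall h \near 0^'+, forall x, semi h (fun y => expR (h * W y) * f y) x <= f x.
Proof. by apply: near_slope_le0 => x; exact: generator_slope_cvg hX _ _ _. Qed.

Lemma near_subsolution W f :
  (forall x, 0 < \sum_y Q x y * f y + W x * f x) ->
  \forall h \near 0^'+, forall x, f x <= semi h (fun y => expR (h * W y) * f y) x.
Proof.
move=> QW.
have : \forall h \near 0^'+, forall x,
    - semi h (fun y => expR (h * W y) * f y) x <= - f x.
  apply: (near_slope_le0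
    (l := fun x => - (\sum_y Q x y * f y + W x * f x))) => x; last first.
    by rewrite oppr_lt0.
  have : - ((semi h (fun y => expR (h * W y) * f y) x - f x) / h) @[h --> 0^'+]
      --> - (\sum_y Q x y * f y + W x * f x).
    by apply: cvgN; exact: generator_slope_cvg hX _ _ _.
  apply: cvg_trans; apply: near_eq_cvg; apply: nearW => h /=.
  by rewrite -opprD mulNr.
by apply: filterS => h H x; rewrite -lerN2.
Qed.

Lemma near_dual_supersolution W m :
  (forall y, \sum_x m x * Q x y + m y * W y < 0) ->
  \forall h \near 0^'+, forall y,
    (\sum_x m x * trans P X h x y) * expR (h * W y) <= m y.
Proof. by apply: near_slope_le0 => x; exact: dual_generator_slope_cvg hX _ _ _. Qed.

Variable T0 : R.
Hypothesis T0_gt0 : 0 < T0.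

Local Notation mesh := (mesh T0).

Definition occupation_sum n (w : Omega) z : R :=
  n.+1%:R^-1 * \sum_(i < n.+1) (X (i.+1%:R * mesh n) w == z)%:R.

Lemma occupation_sum_cvg w z :
  occupation_sum n w z @[n --> \oo] --> occupation X T0 w z.
Proof.
apply: riemann_sum_cvg => // t t0; exact: ctmc_right_continuous hX _ _ _.
Qed.

Lemma occupation_sum_itv n w z : 0 <= occupation_sum n w z <= 1.
Proof.
apply/andP; split; first by rewrite mulr_ge0// ?invr_ge0// sumr_ge0.
rewrite /occupation_sum mulrC ler_pdivrMr// mul1r.
apply: le_trans (ler_sum _ (G := fun=> 1) _) _; first by move=> i _; case: (_ == _).
by rewrite sumr_const card_ord.
Qed.

Lemma occupation_sum_total n w : \sum_z occupation_sum n w z = 1.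
Proof.
rewrite -mulr_sumr exchange_big/= (eq_bigr (fun=> 1)).
  by rewrite sumr_const card_ord mulVf.
move=> i _; rewrite -[RHS](sum_deltal (fun=> 1) (X (i.+1%:R * mesh n) w)).
by apply: eq_bigr => z _; rewrite mulr1.
Qed.

Let mesh_ge0 n i : 0 <= i%:R * mesh n.
Proof. by rewrite mulr_ge0// ltW// mesh_gt0. Qed.

Lemma bmeas_occupation_sum n z : bounded_measurable (fun w => occupation_sum n w z).
Proof.
apply: bmeasM; first exact: bmeas_cst.
apply: bmeas_sum => i.
exact: (bmeas_state hX (fun y => (y == z)%:R) (mesh_ge0 n i.+1)).
Qed.

Lemma occupation_itv w z : 0 <= occupation X T0 w z <= 1.
Proof.
have h := occupation_sum_cvg (w := w) (z := z).
apply/andP; split.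
  apply: (cvgr_to_ge h).
  by apply: nearW => n; have /andP[] := occupation_sum_itv n w z.
apply: (cvgr_to_le h).
by apply: nearW => n; have /andP[] := occupation_sum_itv n w z.
Qed.

Lemma occupation_total w : \sum_z occupation X T0 w z = 1.
Proof.
have h : \sum_z occupation_sum n w z @[n --> \oo] --> \sum_z occupation X T0 w z.
  by apply: cvg_bigsum => z; exact: occupation_sum_cvg.
apply/esym; apply: cvg_unique h => //.
rewrite (_ : (fun n => _) = fun=> 1); first exact: cvg_cst.
by apply/funext => n; rewrite occupation_sum_total.
Qed.

Lemma bmeas_occupation z : bounded_measurable (fun w => occupation X T0 w z).
Proof.
split; last first.
  by exists 1 => w; have /andP[? ?] := occupation_itv w z; rewrite ger0_norm.
apply: (measurable_fun_cvg (h := fun n w => occupation_sum n w z)).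
  by move=> n; case: (bmeas_occupation_sum n z).
by move=> w _; exact: occupation_sum_cvg.
Qed.

(* [occupation] is an average over time, so the pairing of [T0 * W] with it is
   the integral of [W (X t)] over [0, T0]. *)
Local Notation exponent W := (fun z => T0 * W z).

Lemma expR_dot_occupation_sum W n w :
  expR (dot (exponent W) (occupation_sum n w)) =
  \prod_(i < n.+1) expR (mesh n * W (X (i.+1%:R * mesh n) w)).
Proof.
rewrite -expR_sum; congr expR; rewrite /dot /occupation_sum.
under eq_bigr do rewrite mulrA mulr_sumr.
rewrite exchange_big/=; apply: eq_bigr => i _.
rewrite -[RHS](sum_deltal (fun z => mesh n * W z)).
by apply: eq_bigr => z _; rewrite mulrC /mesh mulrAC.
Qed.

Lemma norm_dot_le l (a : S -> R) : (forall z, 0 <= a z <= 1) ->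
  `|dot l a| <= \sum_z `|l z|.
Proof.
move=> a01; apply: le_trans (ler_norm_sum _ _ _) _; apply: ler_sum => z _.
have /andP[a0 a1] := a01 z.
by rewrite normrM (ger0_norm a0) ler_piMr.
Qed.

(** The Feynman-Kac semigroup of [Q + W] at time [T0]. *)
Definition tilt W f x : R :=
  expect (P x) (fun w => expR (dot (exponent W) (occupation X T0 w)) * f (X T0 w)).

Definition tilt_occupation W z f x : R :=
  expect (P x) (fun w => occupation X T0 w z *
    expR (dot (exponent W) (occupation X T0 w)) * f (X T0 w)).

Let dot_cvg l w :
  dot l (occupation_sum n w) @[n --> \oo] --> dot l (occupation X T0 w).
Proof.
by apply: cvg_bigsum => z; apply: cvgMl_tmp; exact: occupation_sum_cvg.
Qed.

Let bmeas_dot l n : bounded_measurable (fun w => dot l (occupation_sum n w)).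
Proof.
apply: bmeas_sum => z; apply: bmeasM; first exact: bmeas_cst.
exact: bmeas_occupation_sum.
Qed.

Let f_bound f : {M : R | 0 <= M & forall y, `|f y| <= M}.
Proof.
exists (\sum_y `|f y|); first exact: sumr_ge0.
by move=> y; rewrite (bigD1 y)//= lerDl sumr_ge0.
Qed.

Let weighted_sum_cvg (c : nat -> Omega -> R) (c' : Omega -> R) l f x :
  (forall n, bounded_measurable (c n)) -> (forall n w, 0 <= c n w <= 1) ->
  (forall w, c n w @[n --> \oo] --> c' w) ->
  expect (P x) (fun w => c n w * expR (dot l (occupation_sum n w)) * f (X T0 w))
    @[n --> \oo] -->
  expect (P x) (fun w => c' w * expR (dot l (occupation X T0 w)) * f (X T0 w)).
Proof.
move=> bc c01 cc'; have [M M0 fM] := f_bound f.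
apply: (expect_cvg (M := expR (\sum_z `|l z|) * M)).
- move=> n; have [] // : bounded_measurable (fun w =>
      c n w * expR (dot l (occupation_sum n w)) * f (X T0 w)).
  apply: bmeasM; last by apply: (bmeas_state hX); exact: ltW.
  by apply: bmeasM => //; exact: bmeas_expR.
- move=> n w; rewrite normrM ler_pM// normrM (ger0_norm (expR_ge0 _)).
  have /andP[c0 c1] := c01 n w; rewrite (ger0_norm c0).
  rewrite (le_trans (ler_piMl (expR_ge0 _) c1))// ler_expR.
  rewrite (le_trans (ler_norm _))//; apply: norm_dot_le => z.
  exact: occupation_sum_itv.
- move=> w; apply: cvgMr_tmp; apply: cvgM; first exact: cc'.
  by apply: continuous_cvg; [exact: continuous_expR|exact: dot_cvg].
Qed.

Lemma tilt_cvg W f x :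
  steps (mesh n) (fun _ y => expR (mesh n * W y)) n.+1 f x @[n --> \oo] -->
  tilt W f x.
Proof.
have -> : tilt W f x = expect (P x) (fun w => 1 *
    expR (dot (exponent W) (occupation X T0 w)) * f (X T0 w)).
  by congr expect; apply/funext => w; rewrite mul1r.
have : expect (P x) (fun w => 1 * expR (dot (exponent W) (occupation_sum n w)) *
      f (X T0 w)) @[n --> \oo] -->
    expect (P x) (fun w => 1 * expR (dot (exponent W) (occupation X T0 w)) *
      f (X T0 w)).
  apply: (weighted_sum_cvg (c := fun _ _ => 1) (c' := fun=> 1)).
  - by move=> n; exact: bmeas_cst.
  - by move=> n w; rewrite ler01 lexx.
  - by move=> w; exact: cvg_cst.
apply: cvg_trans; apply: near_eq_cvg; apply: nearW => n.
rewrite -(expect_weighted_steps hX); last exact/ltW/mesh_gt0.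
congr expect; apply/funext => w.
by rewrite mul1r expR_dot_occupation_sum mesh_end.
Qed.

Lemma tilt_occupation_cvg W z f x :
  n.+1%:R^-1 * (\sum_(j < n.+1) steps (mesh n)
     (fun i y => expR (mesh n * W y) * (if i == j then (y == z)%:R else 1)) n.+1 f x)
    @[n --> \oo] -->
  tilt_occupation W z f x.
Proof.
have := @weighted_sum_cvg (fun n w => occupation_sum n w z)
  (fun w => occupation X T0 w z) (exponent W) f x.
move=> /(_ (fun n => bmeas_occupation_sum n z) (fun n w => occupation_sum_itv n w z)
  (fun w => @occupation_sum_cvg w z)).
apply: cvg_trans; apply: near_eq_cvg; apply: nearW => n.
under eq_bigr => j _.
  rewrite -(expect_weighted_steps hX); last exact/ltW/mesh_gt0.
  over.
rewrite -expect_sum; last first.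
  move=> j; apply: bmeasM; last by apply: (bmeas_state hX); exact: mesh_ge0.
  apply: bmeas_prod => i.
  exact: (bmeas_state hX (fun y => expR (mesh n * W y) *
    (if i == j :> nat then (y == z)%:R else 1)) (mesh_ge0 n i.+1)).
rewrite -expectZ; last first.
  apply: bmeas_sum => j; apply: bmeasM; last by apply: (bmeas_state hX); exact: mesh_ge0.
  apply: bmeas_prod => i.
  exact: (bmeas_state hX (fun y => expR (mesh n * W y) *
    (if i == j :> nat then (y == z)%:R else 1)) (mesh_ge0 n i.+1)).
congr expect; apply/funext => w.
rewrite mesh_end -mulr_suml mulrA; congr (_ * _).
rewrite expR_dot_occupation_sum /occupation_sum -mulrA; congr (_ * _).
rewrite mulr_suml; apply: eq_bigr => j _.
rewrite big_split/= mulrC; congr (_ * _).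
rewrite (bigD1 j)//= eqxx big1 ?mulr1// => i ij.
by rewrite ifN.
Qed.

End tilted_expectations.

(** * Harmonic functions of the tilted semigroup *)

Lemma le_of_le_expR (R : realType) (c a b : R) :
  (forall e, 0 < e -> a <= expR (c * e) * b) -> a <= b.
Proof.
move=> H; have h : expR (c * e) * b @[e --> (0:R)^'+] --> b.
  rewrite -[X in _ --> X]mul1r -(expR0 R); apply: cvgMr_tmp.
  apply: continuous_cvg; first exact: continuous_expR.
  rewrite -[X in _ --> X](mulr0 c); apply: cvgMl_tmp.
  by apply: cvg_at_right_filter; exact: cvg_id.
apply: (cvgr_to_ge h).
have : \forall e \near (0:R)^'+, 0 < e by exact: nbhs_right_gt.
by apply: filterS => e; exact: H.
Qed.

Section feynman_kac.
Context (R : realType) (S : finType) (d : measure_display)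
  (Omega : measurableType d) (P : S -> probability Omega R)
  (X : R -> Omega -> S) (Q : S -> S -> R) (T0 : R).
Hypothesis hX : is_ctmc P X Q.
Hypothesis T0_gt0 : 0 < T0.
Implicit Types (f m u W : S -> R) (x y z : S).

Local Notation mesh := (mesh T0).
Local Notation steps := (weighted_steps P X).
Local Notation T := (tilt P X T0).
Local Notation TL := (tilt_occupation P X T0).

(** Each discretised step lowers a strict supersolution once the mesh is fine
    enough, hence so do all the steps together and their limit; this replaces
    the matrix exponential of [Q + W]. *)
Lemma tilt_supersolution W f x :
  (forall y, \sum_z Q y z * f z + W y * f y < 0) -> T W f x <= f x.
Proof.
move=> /(near_supersolution hX) /(near_mesh T0_gt0) H.
apply: (cvgr_to_le (tilt_cvg hX T0_gt0 (W:=W) (f:=f) (x:=x))).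
apply: filterS H => n H; exact: weighted_steps_supersolution.
Qed.

Lemma tilt_subsolution W f x :
  (forall y, 0 < \sum_z Q y z * f z + W y * f y) -> f x <= T W f x.
Proof.
move=> /(near_subsolution hX) /(near_mesh T0_gt0) H.
apply: (cvgr_to_ge (tilt_cvg hX T0_gt0 (W:=W) (f:=f) (x:=x))).
apply: filterS H => n H; exact: weighted_steps_subsolution.
Qed.

Lemma tilt_dual W m f :
  (forall x, 0 <= m x) -> (forall x, 0 <= f x) ->
  (forall y, \sum_x m x * Q x y + m y * W y < 0) ->
  \sum_x m x * T W f x <= \sum_x m x * f x.
Proof.
move=> m0 f0 /(near_dual_supersolution hX) /(near_mesh T0_gt0) H.
have h : \sum_x m x * steps (mesh n) (fun _ y => expR (mesh n * W y)) n.+1 f x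
    @[n --> \oo] --> \sum_x m x * T W f x.
  by apply: cvg_bigsum => x; apply: cvgMl_tmp; exact: (tilt_cvg hX T0_gt0).
apply: (cvgr_to_le h).
apply: filterS H => n H; exact: weighted_steps_dual.
Qed.

Let eq_weighted_steps h (g g' : nat -> S -> R) n f x :
  (forall i y, (i < n)%N -> g i y = g' i y) ->
  steps h g n f x = steps h g' n f x.
Proof.
elim: n f => [//|n IH] f gg' /=.
rewrite (_ : (fun y => g n y * f y) = (fun y => g' n y * f y)); last first.
  by apply/funext => y; rewrite gg'.
by apply: IH => i y /ltnW; exact: gg'.
Qed.

(** After the marked step the supersolution [f] absorbs the remaining steps,
    and before it [m] absorbs the preceding ones. *)
Let marked_step_le h W m f z (n j : nat) :
  (forall x, 0 <= m x) -> (forall x, 0 <= f x) ->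
  (forall x, semigroup P X h (fun y => expR (h * W y) * f y) x <= f x) ->
  (forall y, (\sum_x m x * trans P X h x y) * expR (h * W y) <= m y) ->
  (j < n)%N ->
  \sum_x m x * steps h
     (fun i y => expR (h * W y) * (if i == j then (y == z)%:R else 1)) n f x
  <= m z * f z.
Proof.
move=> m0 f0 sup dual; elim: n => [//|n IH]; rewrite ltnS leq_eqVlt => jn.
have [->/=|nj] := eqVneq j n.
  rewrite eqxx.
  have : \sum_x m x * steps h (fun _ y => expR (h * W y)) n.+1
      (fun y => (y == z)%:R * f y) x <= \sum_x m x * ((x == z)%:R * f x).
    by apply: weighted_steps_dual => // y; rewrite mulr_ge0.
  have -> : \sum_x m x * ((x == z)%:R * f x) = m z * f z.
    rewrite -(sum_deltar (fun x => m x * f x)).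
    by apply: eq_bigr => x _; rewrite mulrCA mulrC.
  apply: le_trans; rewrite le_eqVlt; apply/orP; left; apply/eqP.
  apply: eq_bigr => x _; congr (_ * _) => /=.
  rewrite (_ : (fun y => _ * _ * f y) =
    (fun y => expR (h * W y) * ((y == z)%:R * f y))); last first.
    by apply/funext => y; rewrite mulrA.
  apply: eq_weighted_steps => i y /ltn_eqF ->; by rewrite mulr1.
move: jn; rewrite (negbTE nj)/= => /IH; apply: le_trans.
apply: ler_sum => x _; apply: ler_wpM2l => //; apply: weighted_steps_le.
  by move=> i y; rewrite mulr_ge0 ?expR_ge0//; case: ifP.
move=> y; rewrite eq_sym (negbTE nj).
by under eq_fun do rewrite mulr1.
Qed.

Lemma tilt_occupation_dual W m f z :
  (forall x, 0 <= m x) -> (forall x, 0 <= f x) ->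
  (forall y, \sum_z Q y z * f z + W y * f y < 0) ->
  (forall y, \sum_x m x * Q x y + m y * W y < 0) ->
  \sum_x m x * TL W z f x <= m z * f z.
Proof.
move=> m0 f0 /(near_supersolution hX) /(near_mesh T0_gt0) H1.
move=> /(near_dual_supersolution hX) /(near_mesh T0_gt0) H2.
have h : \sum_x m x * (n.+1%:R^-1 * \sum_(j < n.+1) steps (mesh n)
     (fun i y => expR (mesh n * W y) * (if i == j then (y == z)%:R else 1)) n.+1 f x)
    @[n --> \oo] --> \sum_x m x * TL W z f x.
  apply: cvg_bigsum => x; apply: cvgMl_tmp.
  exact: (tilt_occupation_cvg hX T0_gt0).
apply: (cvgr_to_le h).
apply: filterS2 H1 H2 => n H1 H2.
under eq_bigr do rewrite mulrCA.
rewrite -mulr_sumr mulrC ler_pdivrMr//.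
under eq_bigr do rewrite mulr_sumr.
rewrite exchange_big/=.
apply: le_trans (ler_sum _ (G := fun=> m z * f z) _) _.
  by move=> j _; have := marked_step_le z m0 f0 H1 H2 (ltn_ord j).
by rewrite sumr_const card_ord mulr_natr.
Qed.

Let bmeas_weight W : bounded_measurable (fun w =>
  expR (dot (fun z => T0 * W z) (occupation X T0 w))).
Proof.
apply: bmeas_expR; apply: bmeas_sum => z; apply: bmeasM; first exact: bmeas_cst.
exact: (bmeas_occupation hX T0_gt0).
Qed.

Let bmeas_end f : bounded_measurable (fun w => f (X T0 w)).
Proof. by apply: (bmeas_state hX); exact: ltW. Qed.

Let bmeas_occ z : bounded_measurable (fun w => occupation X T0 w z : R).
Proof. exact: (bmeas_occupation hX T0_gt0). Qed.

Let weight_shift W c w :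
  expR (dot (fun z => T0 * (W z + c)) (occupation X T0 w)) =
  expR (T0 * c) * expR (dot (fun z => T0 * W z) (occupation X T0 w)).
Proof.
rewrite -expRD addrC; congr expR; rewrite /dot.
under eq_bigr do rewrite mulrDr mulrDl.
by rewrite big_split/= -mulr_sumr (occupation_total hX)// mulr1.
Qed.

(** A constant shift of the potential only rescales, since the occupation
    measure has mass one. Shifts by [- e] and [e] turn a harmonic function into
    a strict super- and subsolution, and [e] is then sent to zero. *)
Lemma tilt_shift W c f x : T (fun z => W z + c) f x = expR (T0 * c) * T W f x.
Proof.
rewrite /tilt -expectZ; last by apply: bmeasM.
by congr expect; apply/funext => w; rewrite weight_shift mulrA.
Qed.

Lemma tilt_occupation_shift W c z f x :
  TL (fun z => W z + c) z f x = expR (T0 * c) * TL W z f x.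
Proof.
rewrite /tilt_occupation -expectZ; last first.
  by apply: bmeasM => //; exact: bmeasM.
by congr expect; apply/funext => w; rewrite weight_shift; ring.
Qed.

Lemma tilt_occupation_total W f x : \sum_z TL W z f x = T W f x.
Proof.
rewrite /tilt_occupation -expect_sum; last first.
  by move=> z; apply: bmeasM => //; exact: bmeasM.
congr expect; apply/funext => w.
by rewrite -!mulr_suml (occupation_total hX)// mul1r.
Qed.

Variables (W u : S -> R).
Hypothesis u_gt0 : forall x, 0 < u x.
Hypothesis u_harmonic : forall x, \sum_y Q x y * u y + W x * u x = 0.

Let harmonic_shift c y : \sum_z Q y z * u z + (W y + c) * u y = c * u y.
Proof. by rewrite mulrDl addrA u_harmonic add0r. Qed.

Lemma tilt_harmonic_le x : T W u x <= u x.
Proof.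
apply: (@le_of_le_expR _ T0) => e e0.
have := @tilt_supersolution (fun z => W z - e) u x _.
rewrite tilt_shift mulrN expRN => H.
rewrite -ler_pdivrMl ?expR_gt0//; apply: H => y.
by rewrite harmonic_shift nmulr_rlt0// oppr_lt0.
Qed.

Lemma tilt_harmonic x : T W u x = u x.
Proof.
apply/eqP; rewrite eq_le tilt_harmonic_le/=.
apply: (@le_of_le_expR _ T0) => e e0.
rewrite -tilt_shift; apply: tilt_subsolution => y.
by rewrite harmonic_shift mulr_gt0.
Qed.

Variable m : S -> R.
Hypothesis m_gt0 : forall x, 0 < m x.
Hypothesis m_harmonic : forall y, \sum_x m x * Q x y + m y * W y = 0.

Let dual_shift c y : \sum_x m x * Q x y + m y * (W y + c) = m y * c.
Proof. by rewrite mulrDr addrA m_harmonic add0r. Qed.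

Let m_ge0 x : 0 <= m x. Proof. exact: ltW. Qed.
Let u_ge0 x : 0 <= u x. Proof. exact: ltW. Qed.

Lemma tilt_dual_harmonic_le f : (forall x, 0 <= f x) ->
  \sum_x m x * T W f x <= \sum_x m x * f x.
Proof.
move=> f0; apply: (@le_of_le_expR _ T0) => e e0.
have E x : (expR (T0 * e))^-1 * T W f x = T (fun z => W z - e) f x.
  by rewrite tilt_shift mulrN expRN.
rewrite -ler_pdivrMl ?expR_gt0// mulr_sumr.
under [X in X <= _]eq_bigr do rewrite mulrCA E.
apply: tilt_dual => // y.
by rewrite dual_shift pmulr_rlt0// oppr_lt0.
Qed.

(** Upper bounds suffice: summed over the states they become an equality,
    because the total mass is known from [tilt_harmonic]. *)
Lemma tilt_occupation_harmonic z : \sum_x m x * TL W z u x = m z * u z.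
Proof.
apply: (@eq_of_le_sum R S (fun z => \sum_x m x * TL W z u x) (fun z => m z * u z)).
  move=> {}z; apply: (@le_of_le_expR _ T0) => e e0.
  have E x : (expR (T0 * e))^-1 * TL W z u x = TL (fun z => W z - e) z u x.
    by rewrite tilt_occupation_shift mulrN expRN.
  rewrite -ler_pdivrMl ?expR_gt0// mulr_sumr.
  under [X in X <= _]eq_bigr do rewrite mulrCA E.
  apply: tilt_occupation_dual => // y.
    by rewrite harmonic_shift nmulr_rlt0// oppr_lt0.
  by rewrite dual_shift pmulr_rlt0// oppr_lt0.
rewrite exchange_big/=; apply: eq_bigr => x _.
by rewrite -mulr_sumr tilt_occupation_total tilt_harmonic.
Qed.

End feynman_kac.

(** * Irreducibility and positivity of the transition probabilities *)

Section irreducibility.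
Context (R : realType) (S : finType) (d : measure_display)
  (Omega : measurableType d) (P : S -> probability Omega R)
  (X : R -> Omega -> S) (Q : S -> S -> R).
Hypothesis hX : is_ctmc P X Q.
Implicit Types (s t h : R) (x y z : S).

Local Notation p := (trans P X).

Lemma generator_ge0 x y : x != y -> 0 <= Q x y.
Proof.
move=> /negbTE xy; apply: (cvgr_to_ge (ctmc_generator hX (x:=x) (y:=y))).
have : \forall h \near (0:R)^'+, 0 < h by exact: nbhs_right_gt.
apply: filterS => h h0; rewrite xy subr0 divr_ge0 ?trans_ge0//.
exact: ltW.
Qed.

Lemma generator_sum0 x : \sum_y Q x y = 0.
Proof.
have h1 : \sum_y ((p h x y - (x == y)%:R) / h) @[h --> (0:R)^'+] --> \sum_y Q x y.
  by apply: cvg_bigsum => y; exact: ctmc_generator hX _ _.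
apply/esym; apply: cvg_unique h1 => //.
apply: cvg_near_cst.
have : \forall h \near (0:R)^'+, 0 < h by exact: nbhs_right_gt.
apply: filterS => h h0; rewrite -mulr_suml sumrB (trans_sum1 hX) ?ltW//.
by under [X in _ - X]eq_bigr do rewrite -[_%:R]mulr1; rewrite sum_deltal subrr mul0r.
Qed.

Let near_trans_diag x : \forall h \near 0^'+, 0 < p h x x.
Proof.
have h1 : (p h x x - 1) / h * h @[h --> (0:R)^'+] --> Q x x * 0.
  apply: cvgM; last by apply: cvg_at_right_filter; exact: cvg_id.
  have := ctmc_generator hX (x:=x) (y:=x); rewrite eqxx.
  exact.
have : \forall h \near (0:R)^'+, 0 < h by exact: nbhs_right_gt.
have : \forall h \near (0:R)^'+, -1 < (p h x x - 1) / h * h.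
  by move/cvgr_gt : h1; apply; rewrite mulr0 oppr_lt0.
by apply: filterS2 => h + h0; rewrite divfK ?gt_eqF// ltrBrDr addNr.
Qed.

Lemma trans_ge_mul s t x y z : 0 <= s -> 0 <= t ->
  p s x z * p t z y <= p (s + t) x y.
Proof.
move=> s0 t0; rewrite (trans_semigroup hX)// (bigD1 z)//= lerDl.
by apply: sumr_ge0 => u _; rewrite mulr_ge0 ?trans_ge0.
Qed.

Lemma trans_diag_gt0 t x : 0 <= t -> 0 < p t x x.
Proof.
rewrite le_eqVlt => /predU1P[<-|t0]; first by rewrite (trans0 hX) eqxx ltr01.
have [n _ /(_ n (leqnn n)) /= pn] := near_mesh t0 (near_trans_diag x).
have m0 : 0 <= mesh t n by rewrite ltW// mesh_gt0.
suff H k : 0 < p (k%:R * mesh t n) x x.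
  by have := H n.+1; rewrite mesh_end.
elim: k => [|k IH]; first by rewrite mul0r (trans0 hX) eqxx ltr01.
rewrite -natr1 mulrDl mul1r (lt_le_trans _ (trans_ge_mul x x x _ m0))//.
  by rewrite mulr_gt0.
by rewrite mulr_ge0.
Qed.

Lemma trans_gt0_le s t x y : 0 <= s -> s <= t -> 0 < p s x y -> 0 < p t x y.
Proof.
move=> s0 st pst; rewrite -(subrKC s t).
rewrite (lt_le_trans _ (trans_ge_mul x y y s0 _)) ?subr_ge0//.
by rewrite mulr_gt0// trans_diag_gt0// subr_ge0.
Qed.

Lemma edge_trans_gt0 t x y : x != y -> 0 < Q x y -> 0 < t -> 0 < p t x y.
Proof.
move=> xy Qxy t0.
have H0 : \forall h \near (0:R)^'+, 0 < h by exact: nbhs_right_gt.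
have H1 : \forall h \near (0:R)^'+, 0 < (p h x y - (x == y)%:R) / h.
  by have /cvgr_gt := ctmc_generator hX (x:=x) (y:=y); apply.
have : \forall h \near (0:R)^'+, 0 < h /\ 0 < p h x y.
  apply: filterS2 H0 H1 => h h0; rewrite (negbTE xy) subr0.
  by rewrite pmulr_lgt0// invr_gt0.
move=> /(near_mesh t0)[n _ /(_ n (leqnn n)) /= [m0 pm]].
apply: trans_gt0_le pm; first exact: ltW.
by rewrite /mesh ler_pdivrMr// ler_peMr ?ler1n// ltW.
Qed.

Hypothesis hirr : irreducible_chain P X.

(** If some state were outside a set closed under the transitions of [Q], the
    indicator of the complement, lifted by a small constant, would be a
    supersolution, and the chain would leave the set with probability zero. *)
Lemma generator_connected (B : S -> Prop) :
  (forall x y, B x -> 0 < Q x y -> B y) -> forall x y, B x -> B y.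
Proof.
move=> Bclosed x y Bx; apply: contrapT => nBy.
have xy : x != y by apply/eqP => e; apply: nBy; rewrite -e.
have [t t0 pt] := hirr x y.
have {}t0 : 0 < t.
  rewrite lt_neqAle t0 andbT; apply/eqP => e.
  by move: pt; rewrite -e (trans0 hX) (negbTE xy) ltxx.
pose delta := p t x y * expR (- t) / 2.
have d0 : 0 < delta by rewrite divr_gt0// mulr_gt0// expR_gt0.
pose f z : R := (~~ `[< B z >])%:R + delta.
have f0 z : 0 < f z by rewrite ltr_wpDl.
have QB z : \sum_b Q z b * (~~ `[< B b >])%:R <= 0.
  have [Bz|nBz] := pselect (B z).
    apply: sumr_le0 => b _; have [Bb|nBb] := pselect (B b).
      by rewrite (asboolT Bb) mulr0.
    rewrite (asboolF nBb) mulr1 leNgt; apply/negP => Qzb.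
    exact/nBb/(Bclosed z).
  have -> : \sum_b Q z b * (~~ `[< B b >])%:R = - \sum_b Q z b * `[< B b >]%:R.
    apply: (addIr (\sum_b Q z b * `[< B b >]%:R)); rewrite addNr -big_split/=.
    apply: etrans (generator_sum0 z); apply: eq_bigr => b _.
    by case: `[< _ >]; rewrite ?(mulr0, mulr1, addr0, add0r).
  rewrite oppr_le0; apply: sumr_ge0 => b _; have [Bb|nBb] := pselect (B b).
    rewrite (asboolT Bb) mulr1; apply: generator_ge0.
    by apply/eqP => e; apply: nBz; rewrite e.
  by rewrite (asboolF nBb) mulr0.
have Qf z : \sum_b Q z b * f b + -1 * f z < 0.
  rewrite -[ltRHS](addr0 0) mulN1r ler_ltD ?oppr_lt0//.
  apply: le_trans (QB z); rewrite le_eqVlt; apply/orP; left; apply/eqP.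
  under eq_bigr do rewrite mulrDr.
  by rewrite big_split/= -mulr_suml generator_sum0 mul0r addr0.
have := tilt_supersolution hX t0 (W := fun=> -1) (f := f) x Qf.
have -> : tilt P X t (fun=> -1) f x = expR (- t) * semigroup P X t f x.
  rewrite -(expect_state hX) ?ltW// -expectZ; last first.
    by apply: (bmeas_state hX); exact: ltW.
  rewrite /tilt; congr expect; apply/funext => w; congr (expR _ * _).
  by rewrite /dot -mulr_sumr (occupation_total hX)// mulr1 mulrN1.
have -> : f x = delta by rewrite /f asboolT// add0r.
apply/negP; rewrite -ltNge /delta -mulrA mulrCA ltr_pM2l ?expR_gt0//.
rewrite ltr_pdivrMr//.
have : p t x y <= semigroup P X t f x.
  rewrite /semigroup (bigD1 y)//= -[leLHS]addr0 lerD//.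
    by rewrite ler_peMr ?trans_ge0// /f asboolF//= lerDl ltW.
  by apply: sumr_ge0 => z _; rewrite mulr_ge0 ?trans_ge0// ltW.
by move=> H; rewrite (le_lt_trans H)// ltr_pMr ?(lt_le_trans pt)// ltr1n.
Qed.

(** The states that can be reached from [x] at all positive times form a set
    closed under the transitions of [Q]. *)
Lemma trans_gt0 t x y : 0 < t -> 0 < p t x y.
Proof.
move=> t0; suff : forall t, 0 < t -> 0 < p t x y by exact.
apply: (@generator_connected (fun z => forall t, 0 < t -> 0 < p t x z) _ x).
  move=> a b pa Qab {t0}t t0; have [<-|ab] := eqVneq a b; first exact: pa.
  have t20 : 0 < t / 2 by rewrite divr_gt0.
  rewrite (splitr t) (lt_le_trans _ (trans_ge_mul x b a _ _)) ?(ltW t20)//.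
  by rewrite mulr_gt0 ?pa// edge_trans_gt0.
by move=> {t0}t t0; rewrite trans_diag_gt0// ltW.
Qed.

End irreducibility.

(** * Cumulants of the bridge occupation measure *)

Section bridge_cumulants.
Context (R : realType) (S : finType) (d : measure_display)
  (Omega : measurableType d) (P : S -> probability Omega R)
  (X : R -> Omega -> S) (Q : S -> S -> R) (T0 : R).
Hypothesis hX : is_ctmc P X Q.
Hypothesis hirr : irreducible_chain P X.
Hypothesis T0_gt0 : 0 < T0.
Implicit Types (f l a : S -> R) (x y z : S).

Local Notation p := (trans P X T0).
Local Notation occ := (occupation X T0).

(** Not normalised: the conditional moment generating function of the bridge
    is [mgf l x y / p x y]. *)
Definition mgf l x y : R :=
  expect (P x) (fun w => expR (dot l (occ w)) * (X T0 w == y)%:R).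

(** The partial derivative of [mgf] with respect to [l z]. *)
Definition mgf_grad l x y z : R :=
  expect (P x) (fun w => occ w z * expR (dot l (occ w)) * (X T0 w == y)%:R).

Let bmeas_exp l : bounded_measurable (fun w => expR (dot l (occ w))).
Proof.
apply: bmeas_expR; apply: bmeas_sum => z; apply: bmeasM; first exact: bmeas_cst.
exact: (bmeas_occupation hX T0_gt0).
Qed.

Let bmeas_end f : bounded_measurable (fun w => f (X T0 w)).
Proof. by apply: (bmeas_state hX); exact: ltW. Qed.

Let bmeas_occ z : bounded_measurable (fun w => occ w z : R).
Proof. exact: (bmeas_occupation hX T0_gt0). Qed.

Let bmeas_mgf l y : bounded_measurable (fun w =>
  expR (dot l (occ w)) * (X T0 w == y)%:R).
Proof. by apply: bmeasM => //; exact: (bmeas_end (fun z => (z == y)%:R)). Qed.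

Let bmeas_grad l y z :
  bounded_measurable (fun w => occ w z * expR (dot l (occ w)) * (X T0 w == y)%:R).
Proof.
apply: bmeasM; first exact: bmeasM.
exact: (bmeas_end (fun z => (z == y)%:R)).
Qed.

Let end_sum f w : f (X T0 w) = \sum_y (X T0 w == y)%:R * f y.
Proof. by rewrite sum_deltal. Qed.

Lemma tilt_mgf W f x : tilt P X T0 W f x = \sum_y mgf (fun z => T0 * W z) x y * f y.
Proof.
rewrite /tilt; under eq_fun do rewrite end_sum mulr_sumr.
rewrite expect_sum; last first.
  move=> y; apply: bmeasM => //; apply: bmeasM; last exact: bmeas_cst.
  exact: (bmeas_end (fun z => (z == y)%:R)).
apply: eq_bigr => y _; rewrite mulrC -expectZ//.
by congr expect; apply/funext => w; ring.
Qed.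

Lemma tilt_occupation_mgf W z f x :
  tilt_occupation P X T0 W z f x = \sum_y mgf_grad (fun z => T0 * W z) x y z * f y.
Proof.
rewrite /tilt_occupation; under eq_fun do rewrite end_sum mulr_sumr.
rewrite expect_sum; last first.
  move=> y; apply: bmeasM; first exact: bmeasM.
  apply: bmeasM; last exact: bmeas_cst.
  exact: (bmeas_end (fun z => (z == y)%:R)).
apply: eq_bigr => y _; rewrite mulrC -expectZ//.
by congr expect; apply/funext => w; ring.
Qed.

Lemma mgf_gt0 l x y : 0 < mgf l x y.
Proof.
have h : 0 < expR (- \sum_z `|l z|) * p x y.
  by rewrite mulr_gt0 ?expR_gt0// (trans_gt0 hX hirr).
apply: lt_le_trans h _.
have -> : p x y = expect (P x) (fun w => (X T0 w == y)%:R).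
  by rewrite (expect_state hX x (fun z => (z == y)%:R)) ?ltW// semigroup_indic.
rewrite -expectZ; last exact: (bmeas_end (fun z => (z == y)%:R)).
apply: expect_le => //.
  apply: bmeasM; first exact: bmeas_cst.
  exact: (bmeas_end (fun z => (z == y)%:R)).
move=> w; rewrite ler_wpM2r// ler_expR.
have := norm_dot_le l (fun z => occupation_itv hX T0_gt0 w z).
by rewrite ler_norml => /andP[].
Qed.

Lemma mgf_grad_ge0 l x y z : 0 <= mgf_grad l x y z.
Proof.
apply: expect_ge0 => w; have /andP[L0 _] := occupation_itv hX T0_gt0 w z.
by rewrite mulr_ge0// mulr_ge0// expR_ge0.
Qed.

Lemma mgf_grad_total l x y : \sum_z mgf_grad l x y z = mgf l x y.
Proof.
rewrite /mgf_grad -expect_sum//; congr expect; apply/funext => w.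
by rewrite -!mulr_suml (occupation_total hX)// mul1r.
Qed.

Lemma mgf0 x y : mgf (fun=> 0) x y = p x y.
Proof.
rewrite -(semigroup_indic P X T0 x y) -(expect_state hX) ?ltW//.
congr expect; apply/funext => w.
by rewrite /dot big1 ?expR0 ?mul1r// => z _; rewrite mul0r.
Qed.

(** Jensen's inequality for the bridge tilted by [l]: the exponential lies above
    its tangent at the mean of [(l' - l) . L], and the linear term of that tangent
    integrates to zero. *)
Lemma mgf_tangent l l' x y :
  expR (dot (fun z => l' z - l z) (fun z => mgf_grad l x y z / mgf l x y)) *
    mgf l x y <= mgf l' x y.
Proof.
set c := dot _ _.
have -> : expR c * mgf l x y = expect (P x) (fun w =>
    expR c * ((1 - c) * (expR (dot l (occ w)) * (X T0 w == y)%:R) +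
    \sum_z (l' z - l z) * (occ w z * expR (dot l (occ w)) * (X T0 w == y)%:R))).
  have b1 : bounded_measurable (fun w =>
      (1 - c) * (expR (dot l (occ w)) * (X T0 w == y)%:R)).
    by apply: bmeasM => //; exact: bmeas_cst.
  have b2 z : bounded_measurable (fun w => (l' z - l z) *
      (occ w z * expR (dot l (occ w)) * (X T0 w == y)%:R)).
    by apply: bmeasM => //; exact: bmeas_cst.
  rewrite expectZ; last by apply: bmeasD => //; exact: bmeas_sum.
  congr (_ * _); rewrite expectD//; last exact: bmeas_sum.
  rewrite expectZ// expect_sum//.
  under eq_bigr do rewrite expectZ//.
  rewrite -/(mgf l x y) mulrBl mul1r -[LHS]addr0 -addrA; congr (_ + _).
  rewrite /c /dot mulr_suml addrC; apply/esym/eqP; rewrite subr_eq0; apply/eqP.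
  apply: eq_bigr => z _; rewrite -mulrA divfK// gt_eqF//; exact: mgf_gt0.
apply: expect_le => //.
  apply: bmeasM; first exact: bmeas_cst.
  apply: bmeasD; first by apply: bmeasM => //; exact: bmeas_cst.
  by apply: bmeas_sum => z; apply: bmeasM => //; exact: bmeas_cst.
move=> w; pose D := dot (fun z => l' z - l z) (occ w).
have -> : dot l' (occ w) = dot l (occ w) + D.
  rewrite /D /dot -big_split/=; apply: eq_bigr => z _; by ring.
have -> : \sum_z (l' z - l z) * (occ w z * expR (dot l (occ w)) * (X T0 w == y)%:R) =
    D * (expR (dot l (occ w)) * (X T0 w == y)%:R).
  by rewrite /D /dot mulr_suml; apply: eq_bigr => z _; ring.
set A := expR (dot l _) * _%:R.
have A0 : 0 <= A by rewrite mulr_ge0// expR_ge0.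
rewrite expRD mulrAC -/A -mulrDl mulrA [leRHS]mulrC ler_wpM2r//.
have -> : expR D = expR c * expR (D - c) by rewrite -expRD addrC subrK.
rewrite ler_wpM2l ?expR_ge0// addrAC -addrA.
exact: expR_ge1Dx.
Qed.

Let measurable_occ : measurable_fun [set: Omega] (occ : Omega -> vec R S).
Proof.
apply: (@measurability _ _ Omega (vec R S) setT _ (@cylinders R S)) => //.
move=> _ [_ [z [B mB ->]] <-]; rewrite setTI.
have [mz _] := bmeas_occ z.
by have := mz measurableT _ mB; rewrite setTI.
Qed.

Let measurable_coord z : measurable_fun [set: vec R S] (fun a : vec R S => a z).
Proof.
move=> _ B mB; rewrite setTI; apply: sub_sigma_algebra.
by exists z; exists B.
Qed.

(** On all sets, measurable or not, [bridge] coincides with the rescaled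
    restriction of [P x] to the end event, so the integral defining [phi] is an
    integral with respect to a measure. *)
Lemma phiE l x y : phi P X T0 x y l = (ln (mgf l x y / p x y))%:E.
Proof.
have p0 : 0 < p x y by exact: (trans_gt0 hX hirr).
have mE : measurable [set w | X T0 w = y].
  by apply: (ctmc_measurable hX); exact: ltW.
have pE : P x [set w | X T0 w = y] = (p x y)%:E.
  by rewrite /trans fineK// fin_num_measure.
have ip0 : 0 <= (p x y)^-1 by rewrite invr_ge0 ltW.
pose nu := mscale (NngNum ip0) (mrestr (P x) mE).
have bridgeE : bridge P X T0 x y = nu.
  apply/funext => A; rewrite /nu /mscale /mrestr /bridge pE/=.
  by rewrite inver gt_eqF// muleC.
have mf : measurable_fun [set: vec R S] (fun a : vec R S => (expR (dot l a))%:E).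
  apply/measurable_EFinP; apply: measurableT_comp => //.
  apply: measurable_sum => z; apply: measurable_funM; first exact: measurable_cst.
  exact: measurable_coord.
rewrite /phi /bridge_law bridgeE ge0_integral_pushforward//.
rewrite [X in integral _ X _](_ : _ = [set: Omega])//.
have mg : measurable_fun setT (fun w => (expR (dot l (occ w)))%:E).
  by apply/measurable_EFinP; case: (bmeas_exp l).
rewrite ge0_integral_mscale//; last by move=> w _; rewrite lee_fin expR_ge0.
rewrite (@ge0_negligible_integral _ _ _ _ setT (~` [set w | X T0 w = y]))//; last 3 first.
- exact: measurableC.
- by move=> w _; rewrite lee_fin expR_ge0.
- by rewrite /= /mrestr setICl measure0.
rewrite setTD setCK (@eq_measure_integral _ _ _ _ (P x)); last first.
  by move=> A _ AE; rewrite /= /mrestr setIidl.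
have -> : (\int[P x]_(w in [set w | X T0 w = y]) (expR (dot l (occ w)))%:E =
    (mgf l x y)%:E)%E.
  rewrite /mgf /expect /Rintegral fineK; last first.
    by apply: integrable_fin_num => //; exact: bmeas_integrable.
  rewrite [LHS]integral_mkcond; apply: eq_integral => w _.
  rewrite /patch; have [wy|wy] := eqVneq (X T0 w) y.
    by rewrite mem_set// mulr1.
  by rewrite memNset ?mulr0//=; exact/eqP.
have -> : ((NngNum ip0)%:num%:E * (mgf l x y)%:E = (mgf l x y / p x y)%:E)%E.
  by rewrite -EFinM/= mulrC.
by rewrite lne_EFin// divr_gt0// mgf_gt0.
Qed.

Lemma phi_conj_ge l x y a :
  ((dot l a - ln (mgf l x y / p x y))%:E <= phi_conj P X T0 x y a)%E.
Proof. by apply: ereal_sup_ubound; exists l => //; rewrite phiE. Qed.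

(** Hence the supremum defining the conjugate at the tilted mean is attained at
    the tilt itself. *)
Lemma log_mgf_tangent l l' x y :
  dot l' (fun z => mgf_grad l x y z / mgf l x y) - ln (mgf l' x y / p x y) <=
  dot l (fun z => mgf_grad l x y z / mgf l x y) - ln (mgf l x y / p x y).
Proof.
have p0 : 0 < p x y by exact: (trans_gt0 hX hirr).
have := mgf_tangent l l' x y; move: (mgf_gt0 l x y) (mgf_gt0 l' x y) p0.
rewrite (_ : dot (fun z => l' z - l z) _ =
    dot l' (fun z => mgf_grad l x y z / mgf l x y) -
    dot l (fun z => mgf_grad l x y z / mgf l x y)); last first.
  by rewrite /dot -sumrB; apply: eq_bigr => z _; rewrite mulrBl.
set D' := dot l' _; set D := dot l _; move: D' D => D' D.
move: (mgf l x y) (mgf l' x y) (p x y) => M M' q M0 M'0 q0 tangent.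
have := tangent; rewrite -ler_ln ?posrE//; last by rewrite mulr_gt0// expR_gt0.
rewrite lnM ?posrE ?expR_gt0// expRK !ln_div ?posrE//.
lra.
Qed.

End bridge_cumulants.

(** * Compactness and entropy *)

Section compactness.
Context (R : realType).

Lemma ultra_bounded_cvg (U : set_system nat) (v : nat -> R) (a b : R) :
  UltraFilter U -> (forall n, a <= v n <= b) -> exists l : R, v n @[n --> U] --> l.
Proof.
move=> UU vab.
have [|l [_ lU]] := @segment_compact R a b (v @ U) _.
  by apply: nearW => n; rewrite /= in_itv/= vab.
exists l => V Vl; have [//|UVC] := in_ultra_setVsetC (v @^-1` V) UU.
by have [r [/=]] := lU (~` V) V UVC Vl.
Qed.

(** One ultrafilter serves all coordinates at once, so no diagonal extraction is
    needed. *)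
Lemma ultra_finite_cvg (I : Type) (U : set_system nat) (v : nat -> I -> R)
    (a b : I -> R) :
  UltraFilter U -> (forall n i, a i <= v n i <= b i) ->
  exists l : I -> R, forall i, v n i @[n --> U] --> l i.
Proof.
move=> UU vab.
have /choice[l lP] : forall i, exists l : R, v n i @[n --> U] --> l.
  by move=> i; apply: (@ultra_bounded_cvg _ _ (a i) (b i)).
by exists l.
Qed.

End compactness.

Section entropy.
Context (R : realType).

Lemma ln_le_sub1 (x : R) : 0 < x -> ln x <= x - 1.
Proof.
by move=> x0; rewrite lerBrDr addrC -[leRHS](lnK x0) expR_ge1Dx.
Qed.

(** The right-hand side is convex in [a]; the left-hand side, affine in [(a, b)],
    touches it where [a = t b]. *)
Lemma entropy_tangent (a b t : R) : 0 < a -> 0 < b -> 0 < t ->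
  a * ln t - b * t + b <= a * ln (a / b) - a + b.
Proof.
move=> a0 b0 t0; have abt : 0 < b * t / a by rewrite divr_gt0// mulr_gt0.
have := ln_le_sub1 abt; rewrite !ln_div ?posrE ?mulr_gt0// lnM ?posrE//.
rewrite -(ler_pM2l a0) [X in _ <= X]mulrBr mulr1 [X in X - a]mulrC divfK ?gt_eqF//.
rewrite !mulrBr mulrDr.
lra.
Qed.

Lemma s_entropy_ge (a b t : R) : 0 <= a -> 0 < t ->
  ((a * ln t - b * t + b)%:E <= s_entropy a b)%E.
Proof.
rewrite le_eqVlt => /predU1P[<-|a0] t0; rewrite /s_entropy.
  rewrite ltxx eqxx/=; case: (leP 0 b) => [b0|_]; last exact: leey.
  by rewrite lee_fin mul0r sub0r gerDr oppr_le0 mulr_ge0// ltW.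
rewrite a0/= (gt_eqF a0)/=; case: (ltP 0 b) => b0; last exact: leey.
by rewrite lee_fin entropy_tangent.
Qed.

(** The affine minorants determine [s_entropy]: take [t = a / b], and let [t] tend
    to zero when [a = 0]. *)
Lemma s_entropy_le (a b e : R) : 0 <= a -> 0 <= b -> (0 < a -> 0 < b) ->
  (forall t, 0 < t -> a * ln t - b * t + b <= e) -> (s_entropy a b <= e%:E)%E.
Proof.
rewrite le_eqVlt => /predU1P[<-|a0] b0 ab H; rewrite /s_entropy.
  rewrite ltxx eqxx b0/= lee_fin.
  have h : 0 * ln t - b * t + b @[t --> (0:R)^'+] --> b.
    rewrite -[X in _ --> X]add0r; apply: cvgD; last exact: cvg_cst.
    rewrite (_ : (fun t => _) = (fun t => - (b * t))); last first.
      by apply/funext => t; rewrite mul0r sub0r.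
    rewrite -[X in _ --> X]oppr0; apply: cvgN.
    rewrite -[X in _ --> X](mulr0 b); apply: cvgMl_tmp.
    by apply: cvg_at_right_filter; exact: cvg_id.
  apply: (cvgr_to_le h).
  have : \forall t \near (0:R)^'+, 0 < t by exact: nbhs_right_gt.
  by apply: filterS => t; exact: H.
have {}b0 := ab a0; rewrite a0 b0/= lee_fin.
have := H (a / b) (divr_gt0 a0 b0).
by rewrite [b * _]mulrC divfK ?gt_eqF.
Qed.

End entropy.

(** * The lower bound on the rate *)

Section lower_bound.
Context (R : realType) (S : finType) (d : measure_display)
  (Omega : measurableType d) (P : S -> probability Omega R)
  (X : R -> Omega -> S) (Q : S -> S -> R) (T0 : R).
Hypothesis hX : is_ctmc P X Q.
Hypothesis hirr : irreducible_chain P X.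
Hypothesis T0_gt0 : 0 < T0.

Local Notation p := (trans P X T0).
Local Notation mgf := (mgf P X T0).

Definition dvg_value (rho u : S -> R) : R :=
  - \sum_x ((\sum_y Q x y * u y) / u x * rho x).

(** The potential for which [Q + potential u] annihilates [u]. *)
Definition potential (u : S -> R) (x : S) : R := - ((\sum_y Q x y * u y) / u x).

Lemma dvg_value_potential rho u : dvg_value rho u = \sum_x potential u x * rho x.
Proof. by rewrite /dvg_value -sumrN; apply: eq_bigr => x _; rewrite mulNr. Qed.

Lemma potential_harmonic u : (forall x, 0 < u x) ->
  forall x, \sum_y Q x y * u y + potential u x * u x = 0.
Proof.
by move=> u0 x; rewrite /potential mulNr divfK ?subrr// gt_eqF.
Qed.

Lemma mgf_harmonic_le u x : (forall x, 0 < u x) ->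
  \sum_y mgf (fun z => T0 * potential u z) x y * u y <= u x.
Proof.
move=> u0; rewrite -(tilt_mgf hX T0_gt0).
exact: (tilt_harmonic_le hX T0_gt0 u0 (potential_harmonic u0)).
Qed.

Lemma sum_telescope (theta : S * S -> R) (v : S -> R) :
  marg1 theta =1 marg2 theta ->
  \sum_x \sum_y theta (x, y) * (v y - v x) = 0.
Proof.
move=> bal; under eq_bigr do under eq_bigr do rewrite mulrBr.
under eq_bigr do rewrite sumrB.
rewrite sumrB [X in X - _]exchange_big/=.
apply/eqP; rewrite subr_eq0; apply/eqP; apply: eq_bigr => x _.
by rewrite -!mulr_suml; congr (_ * _); rewrite [RHS]bal.
Qed.

Lemma dot_sum_k (k : S * S -> S -> R) (rho l : S -> R) :
  (forall z, \sum_xy k xy z = rho z) ->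
  \sum_x \sum_y dot l (k (x, y)) = \sum_z l z * rho z.
Proof.
move=> krho; rewrite pair_big/= /dot exchange_big/=; apply: eq_bigr => z _.
by rewrite -mulr_sumr -krho; congr (_ * _); apply: eq_bigr => -[].
Qed.

(** The trial multiplier is the potential of [u], whose tilted kernel maps [u]
    below itself; conjugating by [u] turns the relative entropy into one with
    respect to a substochastic kernel, up to a telescoping term. *)
Lemma dvg_value_le_rate (rho u : S -> R) (theta : S * S -> R) (k : S * S -> S -> R) :
  (forall x, 0 < u x) -> is_prob theta ->
  (forall z, \sum_xy k xy z = rho z) ->
  ((T0 * dvg_value rho u)%:E <= rate P X T0 k theta)%E.
Proof.
move=> u0 [th0 th1] krho; rewrite /rate; case: asboolP => [[kth bal]|_]; last first.
  exact: leey.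
pose l z := T0 * potential u z.
have mgf0 := mgf_gt0 hX hirr T0_gt0; have p0 x y := trans_gt0 hX hirr x y T0_gt0.
pose A x y := dot l (k (x, y)) - theta (x, y) * ln (mgf l x y / p x y).
pose t x y := mgf l x y / p x y * (u y / u x).
have t0 x y : 0 < t x y by rewrite mulr_gt0 ?divr_gt0.
pose B x y := theta (x, y) * ln (t x y) - marg1 theta x * p x y * t x y
              + marg1 theta x * p x y.
have AB : T0 * dvg_value rho u <= \sum_x \sum_y A x y + \sum_x \sum_y B x y.
  have -> : T0 * dvg_value rho u = \sum_x \sum_y dot l (k (x, y)).
    rewrite (dot_sum_k l krho) dvg_value_potential mulr_sumr.
    by apply: eq_bigr => z _; rewrite mulrA.
  (* the two occurrences of [ln (mgf l x y / p x y)] cancel *)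
  have -> : \sum_x \sum_y A x y + \sum_x \sum_y B x y =
    \sum_x \sum_y dot l (k (x, y)) +
    \sum_x \sum_y theta (x, y) * (ln (u y) - ln (u x)) +
    \sum_x marg1 theta x * (1 - (\sum_y mgf l x y * u y) / u x).
    rewrite -!big_split/=; apply: eq_bigr => x _.
    have -> : marg1 theta x * (1 - (\sum_y mgf l x y * u y) / u x) =
        \sum_y (marg1 theta x * p x y - marg1 theta x * (mgf l x y * u y / u x)).
      rewrite sumrB -!mulr_sumr (trans_sum1 hX x (ltW T0_gt0)).
      by rewrite mulrBr mulr_suml.
    rewrite -!big_split/=; apply: eq_bigr => y _.
    have p0' := p0 x y; have u0' := u0 x; have u0'' := u0 y; have m0 := mgf0 l x y.
    rewrite /A /B /t [ln (_ * (u y / _))]lnM ?posrE ?divr_gt0//.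
    rewrite [ln (u y / u x)]ln_div ?posrE//.
    have -> : marg1 theta x * p x y * (mgf l x y / p x y * (u y / u x)) =
              marg1 theta x * (mgf l x y * u y / u x).
      by field; rewrite !gt_eqF.
    ring.
  rewrite (sum_telescope (fun x => ln (u x)) bal) addr0 lerDl; apply: sumr_ge0 => x _.
  rewrite mulr_ge0//; first by apply: sumr_ge0.
  rewrite subr_ge0 ler_pdivrMr// mul1r.
  exact: mgf_harmonic_le.
apply: (@le_trans _ _ (\sum_x \sum_y A x y + \sum_x \sum_y B x y)%:E).
  by rewrite lee_fin.
rewrite EFinD -!sumEFin; apply: leeD; apply: lee_sum => x _; rewrite -sumEFin;
  apply: lee_sum => y _; last exact: s_entropy_ge.
rewrite /A; case: eqP => [th_eq0|/eqP th_neq0].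
  rewrite th_eq0 mul0r subr0 lee_fin /dot big1// => z _.
  by rewrite kth// mulr0.
have th_gt0 : 0 < theta (x, y) by rewrite lt0r th_neq0 th0.
rewrite -lee_pdivrMl// -EFinM; apply: le_trans (phi_conj_ge hX hirr T0_gt0 l _ _ _).
rewrite lee_fin mulrBr mulKf// lerD2r /dot mulr_sumr.
by under [X in X <= _]eq_bigr do rewrite mulrCA [_ * k _ _]mulrC.
Qed.

End lower_bound.

(** * Maximisers of the Donsker-Varadhan-Gaertner functional *)

Section maximiser.
Context (R : realType) (S : finType) (d : measure_display)
  (Omega : measurableType d) (P : S -> probability Omega R)
  (X : R -> Omega -> S) (Q : S -> S -> R).
Hypothesis hX : is_ctmc P X Q.
Hypothesis hirr : irreducible_chain P X.
Variable rho : S -> R.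

Local Notation dvg_value := (dvg_value Q).

Local Notation C0 := (\sum_x `|Q x x|).

Lemma dvg_valueE (u : S -> R) :
  dvg_value rho u = - \sum_x \sum_y rho x * Q x y * (u y / u x).
Proof.
rewrite /dvg_value; congr (- _); apply: eq_bigr => x _.
by rewrite mulrC mulr_suml mulr_sumr; apply: eq_bigr => y _; ring.
Qed.

Let edge_flow_ge0 (u : S -> R) x y : is_prob rho -> (forall x, 0 < u x) ->
  x != y -> 0 <= rho x * Q x y * (u y / u x).
Proof.
move=> [rho0 _] u0 xy; rewrite mulr_ge0 ?divr_ge0 ?(ltW (u0 _))//.
by rewrite mulr_ge0 ?(generator_ge0 hX).
Qed.

Let exit_rate_le x : is_prob rho -> - (rho x * Q x x) <= `|Q x x|.
Proof.
move=> [rho0 rho1]; have rho_le1 : rho x <= 1.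
  by rewrite -rho1 (bigD1 x)//= lerDl sumr_ge0.
rewrite -mulrN; apply: le_trans (ler_norm _) _.
by rewrite normrM normrN (ger0_norm (rho0 x)) ler_piMl.
Qed.

Let row_le (u : S -> R) x : is_prob rho -> (forall x, 0 < u x) ->
  - \sum_y rho x * Q x y * (u y / u x) <= `|Q x x|.
Proof.
move=> hrho u0; rewrite (bigD1 x)//= divff ?gt_eqF// mulr1 opprD -[leRHS]addr0.
rewrite lerD ?exit_rate_le// oppr_le0; apply: sumr_ge0 => y yx.
by apply: edge_flow_ge0 => //; rewrite eq_sym.
Qed.

Lemma dvg_value_le (u : S -> R) : is_prob rho -> (forall x, 0 < u x) ->
  dvg_value rho u <= C0.
Proof.
move=> hrho u0; rewrite dvg_valueE -sumrN; apply: ler_sum => x _.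
exact: row_le.
Qed.

(** Only the diagonal of [Q] contributes positively, so a single off-diagonal
    term can be kept in the upper bound. *)
Lemma dvg_value_le_edge (u : S -> R) a b :
  is_prob rho -> (forall x, 0 < u x) -> a != b ->
  dvg_value rho u + rho a * Q a b * (u b / u a) <= C0.
Proof.
move=> hrho u0 ab; rewrite dvg_valueE -sumrN (bigD1 a)//= [leRHS](bigD1 a)//= addrAC.
rewrite lerD//; last by apply: ler_sum => x _; exact: row_le.
rewrite (bigD1 a)//= (bigD1 b)/=; last by rewrite eq_sym.
rewrite divff ?gt_eqF// mulr1 !opprD -!addrA -[leRHS]addr0 lerD ?exit_rate_le//.
rewrite addrA addrC addrA subrr add0r oppr_le0.
by apply: sumr_ge0 => y /andP[ya _]; apply: edge_flow_ge0 => //; rewrite eq_sym.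
Qed.

Let dvg_value_expR (v : S -> R) :
  dvg_value rho (fun x => expR (v x)) =
  - \sum_x \sum_y rho x * Q x y * expR (v y - v x).
Proof.
rewrite dvg_valueE; congr (- _); apply: eq_bigr => x _; apply: eq_bigr => y _.
by rewrite expRD expRN.
Qed.

Lemma dvg_value_cvg (U : set_system nat) (v : nat -> S -> R) (l : S -> R) :
  Filter U -> (forall x, v n x @[n --> U] --> l x) ->
  dvg_value rho (fun x => expR (v n x)) @[n --> U] -->
  dvg_value rho (fun x => expR (l x)).
Proof.
move=> FU vl; rewrite dvg_value_expR.
rewrite (_ : (fun n => dvg_value _ _) =
  (fun n => - \sum_x \sum_y rho x * Q x y * expR (v n y - v n x))); last first.
  by apply/funext => n; rewrite dvg_value_expR.
apply: cvgN; apply: cvg_bigsum => x; apply: cvg_bigsum => y.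
apply: cvgMl_tmp; apply: continuous_cvg; first exact: continuous_expR.
exact: cvgB.
Qed.

Hypothesis hrho : is_prob rho.
Hypothesis rho_gt0 : forall x, 0 < rho x.

(** Along an edge of [Q] the increments of the logarithm of a near-maximiser are
    bounded, hence along all pairs of states by connectedness. *)
Lemma log_increments_bounded (v : nat -> S -> R) (K : R) :
  (forall n, K <= dvg_value rho (fun x => expR (v n x))) ->
  forall x y, exists C, forall n, v n y - v n x <= C.
Proof.
move=> Kv x y.
apply: (@generator_connected _ _ _ _ P X Q hX hirr
  (fun z => exists C, forall n, v n z - v n x <= C) _ x); last first.
  by exists 0 => n; rewrite subrr.
move=> a b [C HC] Qab; have [<-|ab] := eqVneq a b; first by exists C.
have rQ : 0 < rho a * Q a b by rewrite mulr_gt0.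
exists ((C0 - K) / (rho a * Q a b) + C) => n.
have := @dvg_value_le_edge (fun x => expR (v n x)) a b hrho (fun x => expR_gt0 _) ab.
rewrite -expRN -expRD => H.
have : v n b - v n a <= (C0 - K) / (rho a * Q a b).
  rewrite ler_pdivlMr// mulrC.
  have e1 : v n b - v n a <= expR (v n b - v n a).
    by rewrite (le_trans _ (expR_ge1Dx _))// lerDr.
  rewrite (le_trans (ler_wpM2l (ltW rQ) e1))//.
  by rewrite lerBrDl (le_trans _ H)// lerD2r.
move=> H1; have := lerD H1 (HC n).
by rewrite addrA subrK.
Qed.

(** The value depends on [u] only up to a factor, and normalising [u] at one state
    confines the logarithms of near-maximisers to a box. *)
Lemma dvg_value_maximiser :
  exists2 u : S -> R, (forall x, 0 < u x) &
    forall u', (forall x, 0 < u' x) -> dvg_value rho u' <= dvg_value rho u.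
Proof.
pose E := [set dvg_value rho u | u in [set u : S -> R | forall x, 0 < u x]].
have Esup : has_sup E.
  split; first by exists (dvg_value rho (fun=> 1)), (fun=> 1) => //= x; exact: ltr01.
  by exists C0 => _ [u u0 <-]; exact: dvg_value_le.
have /choice[v vP] : forall n : nat, exists v : S -> R,
    sup E - n.+1%:R^-1 < dvg_value rho (fun x => expR (v x)).
  move=> n; have n0 : 0 < n.+1%:R^-1 :> R by rewrite invr_gt0.
  have [_ [u u0 <-] H] := sup_adherent n0 Esup.
  exists (fun x => ln (u x)); rewrite (_ : (fun x => expR _) = u)//.
  by apply/funext => x; rewrite lnK// posrE.
have Kv n : sup E - 1 <= dvg_value rho (fun x => expR (v n x)).
  rewrite (le_trans _ (ltW (vP n)))// lerD2l lerN2 invf_le1//.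
  by rewrite ler1n.
have [x0 _|S0] := pickP S; last first.
  by have [_] := hrho; rewrite big_pred0// => /eqP; rewrite eq_sym oner_eq0.
pose w n x := v n x - v n x0.
have wE n : dvg_value rho (fun x => expR (w n x)) =
    dvg_value rho (fun x => expR (v n x)).
  rewrite !dvg_value_expR; congr (- _); apply: eq_bigr => x _; apply: eq_bigr => y _.
  by rewrite /w; congr (_ * expR _); ring.
have /choice[b bP] : forall x, exists C, forall n, w n x <= C.
  by move=> x; exact: log_increments_bounded Kv x0 x.
have /choice[a aP] : forall x, exists C, forall n, C <= w n x.
  move=> x; have [C HC] := log_increments_bounded Kv x x0.
  by exists (- C) => n; rewrite lerNl opprB.
have [U [UU oU]] := @ultraFilterLemma nat \oo _.
have [l lP] := @ultra_finite_cvg R S U w a b UU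
  (fun n i => introT andP (conj (aP i n) (bP i n))).
exists (fun x => expR (l x)) => [x|u' u'0]; first exact: expR_gt0.
have FU : ProperFilter U by exact: ultra_proper.
have h1 : dvg_value rho (fun x => expR (w n x)) @[n --> U] -->
    dvg_value rho (fun x => expR (l x)).
  exact: dvg_value_cvg.
have h2 : sup E - n.+1%:R^-1 @[n --> U] --> sup E.
  apply: (cvg_trans (cvg_app _ oU)).
  rewrite -[X in _ --> X]subr0; apply: cvgB; first exact: cvg_cst.
  exact: cvg_harmonic.
apply: (@le_trans _ _ (sup E)).
  by apply: sup_upper_bound => //; exists u'.
apply: (ler_cvg_to h2 h1); apply: nearW => n.
by rewrite wE ltW.
Qed.

(** Multiplying [u z] by [s] lowers the value by [(s - 1) * (A - B / s)], where
    [A] and [B] are the flows into and out of [z] for the chain transformed by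
    [u]; at a maximiser they balance, which is stationarity of [rho]. *)
Lemma maximiser_dual_harmonic (u : S -> R) : (forall x, 0 < u x) ->
  (forall u', (forall x, 0 < u' x) -> dvg_value rho u' <= dvg_value rho u) ->
  forall z, \sum_x rho x / u x * Q x z + rho z / u z * potential Q u z = 0.
Proof.
move=> u0 umax z.
pose A := \sum_(x | x != z) rho x * Q x z * (u z / u x).
pose B := \sum_(y | y != z) rho z * Q z y * (u y / u z).
pose D := \sum_(x | x != z) \sum_(y | y != z) rho x * Q x y * (u y / u x).
have dvs s : 0 < s ->
    dvg_value rho (fun x => if x == z then s * u x else u x) =
    - (rho z * Q z z + B / s + (A * s + D)).
  move=> s0; rewrite dvg_valueE (bigD1 z)//= (bigD1 z)//= eqxx.
  rewrite divff ?mulf_neq0 ?gt_eqF// mulr1.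
  congr (- (_ + _ + _)).
    rewrite mulr_suml; apply: eq_bigr => y /negbTE ->.
    by field; rewrite !gt_eqF.
  under eq_bigr => x xz do rewrite (bigD1 z)//= eqxx (negbTE xz).
  rewrite big_split/= mulr_suml; congr (_ + _).
    by apply: eq_bigr => x xz; ring.
  by apply: eq_bigr => x xz; apply: eq_bigr => y /negbTE ->.
have dv1 : dvg_value rho u = - (rho z * Q z z + B + (A + D)).
  rewrite -[B]divr1 -[A in A + D]mulr1 -dvs//; congr dvg_value.
  by apply/funext => x; rewrite mul1r; case: ifP.
have key s : 0 < s -> 0 <= (s - 1) * (A * s - B).
  move=> s0; have := umax (fun x => if x == z then s * u x else u x).
  move=> /(_ _)H; have {H} : - (rho z * Q z z + B / s + (A * s + D)) <=
      - (rho z * Q z z + B + (A + D)).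
    by rewrite -dvs// -dv1; apply: H => x; case: ifP => _ //; rewrite mulr_gt0.
  rewrite lerN2 => H.
  have {}H : B + A <= B / s + A * s by lra.
  have : (B + A) * s <= (B / s + A * s) * s by rewrite ler_pM2r.
  rewrite [X in _ <= X]mulrDl divfK ?gt_eqF//.
  move=> {}H; nra.
have AB : A = B.
  have A0 : 0 <= A.
    apply: sumr_ge0 => x xz; rewrite mulr_ge0 ?divr_ge0 ?(ltW (u0 _))//.
    by rewrite mulr_ge0 ?(generator_ge0 hX)// ltW.
  have cA : forall F : set_system R, Filter F -> s @[s --> F] --> (1 : R) ->
      A * s - B @[s --> F] --> A - B.
    move=> F FF F1; rewrite -[X in X - B]mulr1; apply: cvgB; last exact: cvg_cst.
    exact: cvgMl_tmp.
  have hr : A * s - B @[s --> (1:R)^'+] --> A - B.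
    by apply: cA; apply: cvg_at_right_filter; exact: cvg_id.
  have hl : A * s - B @[s --> (1:R)^'-] --> A - B.
    by apply: cA; apply: cvg_at_left_filter; exact: cvg_id.
  apply/eqP; rewrite -subr_eq0 eq_le; apply/andP; split.
    apply: (cvgr_to_le hl).
    have H1 : \forall s \near (1:R)^'-, s < 1 by exact: nbhs_left_lt.
    have H2 : \forall s \near (1:R)^'-, 0 < s by apply: nbhs_left_gt; exact: ltr01.
    apply: filterS2 H1 H2 => s s1 s0; have := key s s0.
    by rewrite nmulr_rge0// subr_lt0.
  apply: (cvgr_to_ge hr).
  have H1 : \forall s \near (1:R)^'+, 1 < s by exact: nbhs_right_gt.
  apply: filterS H1 => s s1; have := key s (lt_trans ltr01 s1).
  by rewrite pmulr_rge0// subr_gt0.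
have -> : \sum_x rho x / u x * Q x z = (A + rho z * Q z z) / u z.
  rewrite (bigD1 z)//= addrC mulrDl; congr (_ + _).
    rewrite mulr_suml; apply: eq_bigr => x xz.
    by field; rewrite !gt_eqF.
  by ring.
rewrite /potential (bigD1 z)//= AB.
have -> : B = rho z * ((\sum_(y | y != z) Q z y * u y) / u z).
  by rewrite mulr_suml mulr_sumr; apply: eq_bigr => y yz; ring.
by field; rewrite gt_eqF.
Qed.

End maximiser.

(** * Attaining the bound *)

Section attainment.
Context (R : realType) (S : finType) (d : measure_display)
  (Omega : measurableType d) (P : S -> probability Omega R)
  (X : R -> Omega -> S) (Q : S -> S -> R) (T0 : R).
Hypothesis hX : is_ctmc P X Q.
Hypothesis hirr : irreducible_chain P X.
Hypothesis T0_gt0 : 0 < T0.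

Local Notation p := (trans P X T0).
Local Notation mgf := (mgf P X T0).
Local Notation mgf_grad := (mgf_grad P X T0).
Local Notation dvg_value := (dvg_value Q).

(** [c] and [e] bound the two terms of the rate functional from above. Both terms
    are suprema of affine functions of the pair [(theta, k)], and it is these
    affine functions that are compared with [c] and [e]. *)
Record plan (rho : S -> R) (B : R) (theta : S * S -> R) (k : S * S -> S -> R)
    (c e : S * S -> R) : Prop := Plan {
  plan_prob : is_prob theta;
  plan_balanced : marg1 theta =1 marg2 theta;
  plan_occupation_ge0 : forall xy z, 0 <= k xy z;
  plan_occupation_total : forall xy, \sum_z k xy z = theta xy;
  plan_occupation : forall z, \sum_xy k xy z = rho z;
  plan_bridge_cost : forall x y l,
    dot l (k (x, y)) - theta (x, y) * ln (mgf l x y / p x y) <= c (x, y);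
  plan_entropy_cost : forall x y t, 0 < t ->
    theta (x, y) * ln t - marg1 theta x * p x y * t + marg1 theta x * p x y
      <= e (x, y);
  plan_cost : \sum_xy (c xy + e xy) <= B }.

Lemma plan_rate_le rho B theta k c e :
  plan rho B theta k c e -> (rate P X T0 k theta <= B%:E)%E.
Proof.
case=> [[th0 th1] bal k0 kth krho hc he hB].
have p0 x y : 0 < p x y by exact: (trans_gt0 hX hirr).
have kac : abs_cont k theta.
  move=> xy th_eq0 z; have k0' i : true -> 0 <= k xy i by move=> _; exact: k0.
  by apply: (psumr_eq0P k0') => //; rewrite kth.
have c0 x y : 0 <= c (x, y).
  have := hc x y (fun=> 0); rewrite (mgf0 hX T0_gt0) divff ?gt_eqF//.
  rewrite ln1 mulr0 subr0.
  by rewrite /dot big1 // => z _; rewrite mul0r.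
have marg_ge x y : theta (x, y) <= marg1 theta x.
  by rewrite /marg1 (bigD1 y)//= lerDl sumr_ge0.
rewrite /rate asboolT//.
apply: (@le_trans _ _ (\sum_x \sum_y (c (x, y) + e (x, y)))%:E); last first.
  rewrite lee_fin (le_trans _ hB)// pair_big/= le_eqVlt; apply/orP; left; apply/eqP.
  by apply: eq_bigr => -[].
rewrite [X in (_ <= X%:E)%E](_ : _ =
  \sum_x \sum_y c (x, y) + \sum_x \sum_y e (x, y)); last first.
  by rewrite -big_split/=; apply: eq_bigr => x _; rewrite big_split.
rewrite EFinD -!sumEFin; apply: leeD; apply: lee_sum => x _; rewrite -sumEFin;
  apply: lee_sum => y _.
  case: eqP => [_|/eqP th_neq0]; first by rewrite lee_fin.
  have th_gt0 : 0 < theta (x, y) by rewrite lt0r th_neq0 th0.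
  rewrite muleC -lee_pdivlMr//; apply: ge_ereal_sup => _ [l _ <-].
  rewrite (phiE hX hirr T0_gt0) -EFinB -EFinM lee_fin ler_pdivlMr//.
  apply: le_trans (hc x y l); rewrite mulrBl [ln _ * _]mulrC lerD2r.
  rewrite /dot mulr_suml le_eqVlt; apply/orP; left; apply/eqP.
  by apply: eq_bigr => z _; rewrite -mulrA divfK.
have m0 : 0 <= marg1 theta x by apply: sumr_ge0.
apply: s_entropy_le => //.
- by rewrite mulr_ge0// ltW.
- by move=> th_gt0; rewrite mulr_gt0// (lt_le_trans th_gt0).
- exact: he.
Qed.

(** All the constraints are weak linear inequalities in [theta], [k], [c] and
    [e], so they survive passing to limits along an ultrafilter. *)
Lemma plan_closed (rho : nat -> S -> R) (B : nat -> R) (rho' : S -> R) (B' M : R) :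
  (forall z, rho n z @[n --> \oo] --> rho' z) -> B n @[n --> \oo] --> B' ->
  (forall n, B n <= M) ->
  (forall n, exists theta k c e, plan (rho n) (B n) theta k c e) ->
  exists theta k c e, plan rho' B' theta k c e.
Proof.
move=> rhol Bl BM /choice[th /choice[k /choice[c /choice[e H]]]].
have [U [UU oU]] := @ultraFilterLemma nat \oo _.
have FU : ProperFilter U by exact: ultra_proper.
have th01 n xy : 0 <= th n xy <= 1.
  have [[th0 th1] _ _ _ _ _ _ _] := H n.
  by rewrite th0 -th1 (bigD1 xy)//= lerDl sumr_ge0.
have k01 n (i : S * S * S) : 0 <= k n i.1 i.2 <= 1.
  have [[th0 th1] _ k0 kth _ _ _ _] := H n.
  rewrite k0/= (le_trans _ (proj2 (andP (th01 n i.1))))// -kth.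
  by rewrite (bigD1 i.2)//= lerDl sumr_ge0.
have c0 n xy : 0 <= c n xy.
  case: xy => x y; have [_ _ _ _ _ hc _ _] := H n.
  have := hc x y (fun=> 0); rewrite (mgf0 hX T0_gt0) divff ?gt_eqF//; last first.
    exact: (trans_gt0 hX hirr).
  rewrite ln1 mulr0 subr0.
  by rewrite /dot big1 // => z _; rewrite mul0r.
have e0 n xy : 0 <= e n xy.
  case: xy => x y; have [_ _ _ _ _ _ he _] := H n.
  by have := he x y 1 ltr01; rewrite ln1 mulr0 sub0r mulr1 addNr.
have ceM n xy : c n xy + e n xy <= M.
  have [_ _ _ _ _ _ _ hB] := H n.
  rewrite (le_trans _ (BM n))// (le_trans _ hB)// (bigD1 xy)//= lerDl.
  by apply: sumr_ge0 => i _; rewrite addr_ge0.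
have cM n xy : 0 <= c n xy <= M.
  by rewrite c0 (le_trans _ (ceM n xy))// lerDl.
have eM n xy : 0 <= e n xy <= M.
  by rewrite e0 (le_trans _ (ceM n xy))// lerDr.
have [th' thl] := ultra_finite_cvg UU th01.
have [k' kl] := @ultra_finite_cvg R _ U (fun n i => k n i.1 i.2) _ _ UU k01.
have [c' cl] := ultra_finite_cvg UU cM.
have [e' el] := ultra_finite_cvg UU eM.
have {}rhol z : rho n z @[n --> U] --> rho' z.
  exact: (cvg_trans (cvg_app _ oU) (rhol z)).
have {}Bl : B n @[n --> U] --> B' by exact: (cvg_trans (cvg_app _ oU) Bl).
have {}kl xy z : k n xy z @[n --> U] --> k' (xy, z) by exact: (kl (xy, z)).
have m1l x : marg1 (th n) x @[n --> U] --> marg1 th' x.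
  by apply: cvg_bigsum => y; exact: thl.
have m2l x : marg2 (th n) x @[n --> U] --> marg2 th' x.
  by apply: cvg_bigsum => y; exact: thl.
have uniq (f g : nat -> R) (a b : R) : f =1 g -> f n @[n --> U] --> a ->
    g n @[n --> U] --> b -> a = b.
  by move=> /funext -> fa gb; apply: cvg_unique fa gb.
exists th', (fun xy z => k' (xy, z)), c', e'; split.
- split=> [xy|].
    by apply: (cvgr_to_ge (thl xy)); apply: nearW => n; have /andP[] := th01 n xy.
  apply: (uniq (fun n => \sum_xy th n xy) (fun=> 1)); last exact: cvg_cst.
    by move=> n; have [_] := plan_prob (H n).
  by apply: cvg_bigsum => xy; exact: thl.
- move=> x; apply: (uniq (fun n => marg1 (th n) x) (fun n => marg2 (th n) x)) => // n.
  exact: (plan_balanced (H n)).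
- move=> xy z; apply: (cvgr_to_ge (kl xy z)); apply: nearW => n.
  exact: (plan_occupation_ge0 (H n)).
- move=> xy; apply: (uniq (fun n => \sum_z k n xy z) (fun n => th n xy)) => //.
    by move=> n; exact: (plan_occupation_total (H n)).
  by apply: cvg_bigsum => z; exact: kl.
- move=> z; apply: (uniq (fun n => \sum_xy k n xy z) (fun n => rho n z)) => //.
    by move=> n; exact: (plan_occupation (H n)).
  by apply: cvg_bigsum => xy; exact: kl.
- move=> x y l.
  have h : dot l (k n (x, y)) - th n (x, y) * ln (mgf l x y / p x y) @[n --> U] -->
      dot l (fun z => k' (x, y, z)) - th' (x, y) * ln (mgf l x y / p x y).
    apply: cvgB; last by apply: cvgMr_tmp; exact: thl.
    by apply: cvg_bigsum => z; apply: cvgMl_tmp; exact: kl.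
  apply: (ler_cvg_to h (cl (x, y))); apply: nearW => n.
  exact: (plan_bridge_cost (H n)).
- move=> x y t t0.
  have h : th n (x, y) * ln t - marg1 (th n) x * p x y * t + marg1 (th n) x * p x y
      @[n --> U] -->
      th' (x, y) * ln t - marg1 th' x * p x y * t + marg1 th' x * p x y.
    apply: cvgD; last by apply: cvgMr_tmp; exact: m1l.
    apply: cvgB; first by apply: cvgMr_tmp; exact: thl.
    by apply: cvgMr_tmp; apply: cvgMr_tmp; exact: m1l.
  apply: (ler_cvg_to h (el (x, y))); apply: nearW => n.
  exact: (plan_entropy_cost (H n)).
- have h : \sum_xy (c n xy + e n xy) @[n --> U] --> \sum_xy (c' xy + e' xy).
    by apply: cvg_bigsum => xy; apply: cvgD; [exact: cl|exact: el].
  apply: (ler_cvg_to h Bl); apply: nearW => n.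
  exact: (plan_cost (H n)).
Qed.

(** The optimal plan is read off the Doob transform by the maximiser [u]: its
    kernel over time [T0] is [M x y * u y / u x] with [M] the tilted kernel,
    [rho] is stationary for it, and [k] collects the expected occupation
    measures of its bridges. *)
Lemma positive_plan (rho : S -> R) (B : R) : is_prob rho -> (forall x, 0 < rho x) ->
  (forall u, (forall x, 0 < u x) -> T0 * dvg_value rho u <= B) ->
  exists theta k c e, plan rho B theta k c e.
Proof.
move=> hrho rho0 dvB.
have [u u0 umax] := dvg_value_maximiser hX hirr hrho rho0.
pose l z := T0 * potential Q u z; pose m x := rho x / u x.
have m0 x : 0 < m x by rewrite divr_gt0.
have harm := potential_harmonic Q u0.
have dual := maximiser_dual_harmonic hX rho0 u0 umax.
have M0 x y := mgf_gt0 hX hirr T0_gt0 l x y.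
have p0 x y := trans_gt0 hX hirr x y T0_gt0.
have Mu x : \sum_y mgf l x y * u y = u x.
  by rewrite -(tilt_mgf hX T0_gt0); exact: (tilt_harmonic hX T0_gt0 u0 harm).
have muE x : m x * u x = rho x by rewrite divfK// gt_eqF.
have mM y : \sum_x m x * mgf l x y * u y = rho y.
  rewrite -muE; apply: (@eq_of_le_sum _ _ (fun y => \sum_x m x * mgf l x y * u y)
     (fun y => m y * u y) _ _ y) => [{}y|].
    rewrite -mulr_suml ler_wpM2r ?(ltW (u0 _))//.
    have f0 x : (0 : R) <= (x == y)%:R by [].
    have := tilt_dual_harmonic_le hX T0_gt0 m0 dual f0.
    under eq_bigr => x _.
      rewrite (tilt_mgf hX T0_gt0) sum_deltar.
      over.
    by rewrite sum_deltar.
  rewrite exchange_big/=; apply: eq_bigr => x _.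
  by rewrite -[in RHS]Mu mulr_sumr; apply: eq_bigr => y' _; rewrite mulrA.
have mN z : \sum_x \sum_y m x * mgf_grad l x y z * u y = rho z.
  rewrite -muE -(tilt_occupation_harmonic hX T0_gt0 u0 harm m0 dual z).
  apply: eq_bigr => x _; rewrite (tilt_occupation_mgf hX T0_gt0) mulr_sumr.
  by apply: eq_bigr => y _; rewrite mulrA.
pose th (xy : S * S) := m xy.1 * mgf l xy.1 xy.2 * u xy.2.
pose k (xy : S * S) z := m xy.1 * mgf_grad l xy.1 xy.2 z * u xy.2.
pose a x y z := mgf_grad l x y z / mgf l x y.
pose c (xy : S * S) :=
  th xy * (dot l (a xy.1 xy.2) - ln (mgf l xy.1 xy.2 / p xy.1 xy.2)).
pose e (xy : S * S) := th xy * ln (th xy / (rho xy.1 * p xy.1 xy.2)) - th xy +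
  rho xy.1 * p xy.1 xy.2.
have th0 xy : 0 < th xy by apply: mulr_gt0; [exact: mulr_gt0|exact: u0].
have th1 x : marg1 th x = rho x.
  rewrite /marg1 /th/= -muE -[in RHS]Mu mulr_sumr.
  by apply: eq_bigr => y _; rewrite mulrA.
have th2 y : marg2 th y = rho y by exact: mM.
have sum_th : \sum_xy th xy = 1.
  have [_ <-] := hrho; under [RHS]eq_bigr do rewrite -th1.
  by rewrite pair_big/=; apply: eq_bigr => -[].
have kE x y l' : dot l' (k (x, y)) = th (x, y) * dot l' (a x y).
  rewrite /dot mulr_sumr; apply: eq_bigr => z _; rewrite /k /th /a/=.
  by have M0' := M0 x y; field; rewrite gt_eqF.
have krho z : \sum_xy k xy z = rho z.
  by rewrite -(mN z) pair_big/=; apply: eq_bigr => -[].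
have bal : marg1 th =1 marg2 th by move=> x; rewrite th1 th2.
exists th, k, c, e; split => //.
- by split=> // xy; exact: ltW.
- move=> xy z; apply: mulr_ge0; last exact: ltW.
  by apply: mulr_ge0; [exact: ltW|exact: (mgf_grad_ge0 hX T0_gt0)].
- move=> xy; rewrite /k -mulr_suml -mulr_sumr.
  by rewrite (mgf_grad_total hX T0_gt0).
- move=> x y l'; rewrite kE -mulrBr /c/= ler_wpM2l ?(ltW (th0 _))//.
  exact: (log_mgf_tangent hX hirr T0_gt0).
- by move=> x y t t0; rewrite th1; apply: entropy_tangent => //; exact: mulr_gt0.
apply: le_trans (dvB u u0); rewrite le_eqVlt; apply/orP; left; apply/eqP.
have ceE x y : c (x, y) + e (x, y) =
    dot l (k (x, y)) + th (x, y) * (ln (u y) - ln (u x)) - th (x, y) + rho x * p x y.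
  rewrite kE /c /e/=.
  have -> : th (x, y) / (rho x * p x y) = mgf l x y / p x y * (u y / u x).
    rewrite /th/= -(muE x).
    have m0' := m0 x; have u0' := u0 x; have p0' := p0 x y.
    by field; rewrite !gt_eqF.
  rewrite [ln (_ * (u y / _))]lnM ?posrE ?divr_gt0// [ln (u y / _)]ln_div ?posrE//.
  ring.
rewrite (eq_bigr (fun xy => c (xy.1, xy.2) + e (xy.1, xy.2))); last by case.
rewrite -(pair_bigA _ (fun x y => c (x, y) + e (x, y)))/=.
under eq_bigr do under eq_bigr do rewrite ceE.
under eq_bigr do rewrite !big_split/= sumrN.
rewrite !big_split/= sumrN (dot_sum_k l krho).
rewrite (sum_telescope (fun x => ln (u x)) bal) addr0.
have -> : \sum_x \sum_y th (x, y) = 1.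
  by rewrite -sum_th pair_big/=; apply: eq_bigr => -[].
have -> : \sum_x \sum_y rho x * p x y = 1.
  have [_ <-] := hrho; apply: eq_bigr => x _.
  by rewrite -mulr_sumr (trans_sum1 hX x (ltW T0_gt0)) mulr1.
rewrite subrK dvg_value_potential mulr_sumr.
by apply: eq_bigr => z _; rewrite mulrA.
Qed.

End attainment.

(** * The variational formula *)

Section value.
Context (R : realType) (S : finType) (d : measure_display)
  (Omega : measurableType d) (P : S -> probability Omega R)
  (X : R -> Omega -> S) (Q : S -> S -> R) (T0 : R).
Hypothesis hX : is_ctmc P X Q.
Hypothesis hirr : irreducible_chain P X.
Hypothesis T0_gt0 : 0 < T0.
Variable rho : S -> R.
Hypothesis hrho : is_prob rho.

Local Notation dvg_value := (dvg_value Q).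

Lemma I_DVG_finite : exists2 I : R, I_DVG Q rho = I%:E &
  forall u, (forall x, 0 < u x) -> dvg_value rho u <= I.
Proof.
have dvI u : (forall x, 0 < u x) -> ((dvg_value rho u)%:E <= I_DVG Q rho)%E.
  by move=> u0; apply: ereal_sup_ubound; exists u.
have ub : (I_DVG Q rho <= (\sum_x `|Q x x|)%:E)%E.
  apply: ge_ereal_sup => _ [u u0 <-]; rewrite lee_fin.
  exact: (dvg_value_le hX hrho u0).
have lb := dvI (fun=> 1) (fun=> ltr01).
have If : I_DVG Q rho \is a fin_num.
  rewrite fin_numE; apply/andP; split; apply/eqP => E.
    by move: lb; rewrite E leeNy_eq.
  by move: ub; rewrite E leye_eq.
exists (fine (I_DVG Q rho)); first by rewrite fineK.
by move=> u u0; rewrite -lee_fin fineK//; exact: dvI.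
Qed.

Lemma dvg_value_mix (a b : R) (rho1 rho2 u : S -> R) :
  dvg_value (fun x => a * rho1 x + b * rho2 x) u =
  a * dvg_value rho1 u + b * dvg_value rho2 u.
Proof.
rewrite !dvg_value_potential !mulr_sumr -big_split/=; apply: eq_bigr => x _; ring.
Qed.

(** Mixing [rho] with the uniform law makes it positive at a cost that vanishes
    with the weight of the mixture. *)
Lemma optimal_plan (I : R) :
  (forall u, (forall x, 0 < u x) -> dvg_value rho u <= I) ->
  exists theta k c e, plan P X T0 rho (T0 * I) theta k c e.
Proof.
move=> dvI; have [rho0 rho1] := hrho.
pose C := \sum_x `|Q x x|.
have C_ge0 : 0 <= C by apply: sumr_ge0.
pose unif (x : S) : R := #|S|%:R^-1.
have S_gt0 : (0 < #|S|)%N.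
  rewrite lt0n; apply/eqP => S0; move: rho1; rewrite big1 => [/eqP|x _].
    by rewrite eq_sym oner_eq0.
  by have := fintype0 x S0.
have unif_prob : is_prob unif.
  split=> [x|]; first by rewrite invr_ge0.
  by rewrite /unif sumr_const -[_ *+ _]mulr_natr mulVf// pnatr_eq0 -lt0n.
pose eps (n : nat) : R := n.+1%:R^-1.
have eps_gt0 n : 0 < eps n by rewrite invr_gt0.
have eps_le1 n : eps n <= 1 by rewrite invf_le1// ler1n.
have eps_cvg : eps n @[n --> \oo] --> (0 : R) by exact: cvg_harmonic.
have eps'_cvg : 1 - eps n @[n --> \oo] --> (1 : R).
  by rewrite -[X in _ --> X]subr0; apply: cvgB => //; exact: cvg_cst.
apply: (@plan_closed R S d Omega P X Q T0 hX hirr T0_gt0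
  (fun n z => (1 - eps n) * rho z + eps n * unif z)
  (fun n => T0 * ((1 - eps n) * I + eps n * C)) rho (T0 * I) (T0 * (`|I| + C))).
- move=> z; rewrite -[X in _ --> X]addr0 -[X in _ --> X + _]mul1r.
  rewrite -[X in _ + X](mul0r (unif z)).
  by apply: cvgD; exact: cvgMr_tmp.
- apply: cvgMl_tmp; rewrite -[X in _ --> X]addr0 -[X in _ --> X + _]mul1r.
  rewrite -[X in _ + X](mul0r C).
  by apply: cvgD; exact: cvgMr_tmp.
- move=> n; rewrite ler_pM2l// lerD//; last by rewrite ler_piMl.
  apply: le_trans (ler_wpM2l _ (ler_norm I)) _; first by rewrite subr_ge0.
  by rewrite ler_piMl// gerBl ltW.
move=> n; apply: (positive_plan hX hirr T0_gt0).
- split=> [x|].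
    by rewrite addr_ge0// mulr_ge0 ?subr_ge0 ?invr_ge0// ltW.
  rewrite big_split/= -!mulr_sumr rho1; have [_ ->] := unif_prob.
  by rewrite !mulr1 subrK.
- move=> x; rewrite ltr_wpDl ?mulr_ge0 ?subr_ge0//.
  by rewrite mulr_gt0// invr_gt0 ltr0n.
- move=> u u0; rewrite ler_pM2l// dvg_value_mix lerD//.
    by rewrite ler_wpM2l ?subr_ge0// dvI.
  by rewrite ler_wpM2l ?(ltW (eps_gt0 n))//; exact: (dvg_value_le hX unif_prob u0).
Qed.

End value.

Theorem corollary1p2 (R : realType) (S : finType) (d : measure_display)
  (Omega : measurableType d) (P : S -> probability Omega R)
  (X : R -> Omega -> S) (Q : S -> S -> R) (T0 : R) (hT0 : 0 < T0)
  (hX : is_ctmc P X Q) (hirr : irreducible_chain P X)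
  (rho : S -> R) (hrho : is_prob rho) :
  I_DVG Q rho =
  ((T0^-1)%:E *
   ereal_inf [set
     ereal_inf [set rate P X T0 k theta
               | k in [set k : S * S -> S -> R |
                         forall z, (\sum_xy k xy z)%R = rho z]]
     | theta in [set theta : S * S -> R |
                   is_prob theta /\ marg1 theta =1 marg2 theta]])%E.
Proof.
have [I IE dvI] := I_DVG_finite hX hrho.
set J := ereal_inf _.
suff -> : J = (T0 * I)%:E by rewrite IE -EFinM mulKf// gt_eqF.
apply/eqP; rewrite eq_le; apply/andP; split.
  have [theta [k [c [e pl]]]] := optimal_plan hX hirr hT0 hrho dvI.
  apply: le_trans (plan_rate_le hX hirr hT0 pl).
  apply: (@le_trans _ _ (ereal_inf [set rate P X T0 k theta
      | k in [set k : S * S -> S -> R | forall z, (\sum_xy k xy z)%R = rho z]])).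
    apply: ereal_inf_lbound; exists theta => //.
    by split; [exact: plan_prob pl|exact: plan_balanced pl].
  by apply: ereal_inf_lbound; exists k => //; exact: plan_occupation pl.
apply: le_ereal_inf_tmp => _ [theta [hth _] <-].
apply: le_ereal_inf_tmp => _ [k krho <-].
rewrite EFinM -lee_pdivlMl// -IE; apply: ge_ereal_sup => _ [u u0 <-].
rewrite lee_pdivlMl// -EFinM.
exact: (dvg_value_le_rate hX hirr hT0).
Qed.
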